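(* Let $1 < p < \infty$ and let $w$ be a weight on $\mathbb{R}^n$. Then the following are equivalent: (i) there is a constant $C<\infty$, independent of $f$, such that $$\|w^{\frac{1}{p}}Mf\|_{L^{p,\infty}} \le C\, \|f\|_{L^p(w)}\qquad\text{for each } f \in L^p(w);$$ (ii) $w \in A_p^*$.
   Context: A weight is a measurable function on $\mathbb{R}^n$ that is non-negative a.e. Cubes are cubes in $\mathbb{R}^n$ with sides parallel to the coordinate axes; $|E|$ is Lebesgue measure and $\frac{1}{|Q|}\int_Q$ is the integral average. $L^p(w)$ consists of the measurable $f$ with $\|f\|_{L^p(w)} := \left(\int_{\mathbb{R}^n}|f|^p w\,dx\right)^{1/p}<\infty$. Hardy-Littlewood maximal operator: $Mf(x) := \sup_Q \frac{1}{|Q|}\int_Q |f(y)|\,dy\cdot \chi_Q(x)$, the supremum over all cubes $Q$ (values in $[0,\infty]$; $Mf=\infty$ is allowed). Weak $L^p$ quasi-norm, $1\le p<\infty$: $\|f\|_{L^{p,\infty}} := \sup_{\lambda>0}\lambda\,|\{x\in\mathbb{R}^n : |f(x)|>\lambda\}|^{1/p}$. Let $p'=p/(p-1)$. For $1<p<\infty$, $w\in A_p^*$ means $$[w]_{A_p^*} := \sup_{Q}\frac{1}{|Q|}\left\|w \chi_Q\right\|_{L^{1,\infty}}\left(\frac{1}{|Q|}\int_Q w^{1-p'}\,dx\right)^{p-1} < \infty,$$ the supremum over all cubes $Q$. Here $w^{1-p'}=\infty$ where $w=0$, and the convention $0\cdot\infty=0$ is used throughout. *)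

(* Defs.v *)
From HB Require Import structures.
From mathcomp Require Import all_boot all_order all_algebra.
From mathcomp Require Import all_classical all_reals all_analysis.
Set Implicit Arguments.
Unset Strict Implicit.
Unset Printing Implicit Defensive.
Import Order.TTheory GRing.Theory Num.Theory.
Import numFieldNormedType.Exports.
Local Open Scope classical_set_scope.
Local Open Scope ring_scope.
Local Open Scope ereal_scope.

Section LebesgueRn.
Context {R : realType}.
Notation borelR := (measurableTypeR R).

Definition tcons n (xy : borelR * n.-tuple borelR) : n.+1.-tuple borelR :=
  [the n.+1.-tuple borelR of xy.1 :: xy.2].

Lemma measurable_tcons n : measurable_fun [set: borelR * n.-tuple borelR] (@tcons n).
Proof. exact: measurable_cons. Qed.

Section Step.
Context (n : nat) (m : {sigma_finite_measure set (n.-tuple borelR) -> \bar R}).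

Definition borel_lebesgue_step : set (n.+1.-tuple borelR) -> \bar R :=
  pushforward ((@lebesgue_measure R) \x m) (@tcons n).

Let step0 : borel_lebesgue_step set0 = 0.
Proof. by rewrite /borel_lebesgue_step /pushforward preimage_set0 measure0. Qed.

Let step_ge0 A : 0 <= borel_lebesgue_step A.
Proof. by rewrite /borel_lebesgue_step /pushforward measure_ge0. Qed.

Let step_sigma_additive : semi_sigma_additive borel_lebesgue_step.
Proof.
move=> F mF tF mUF; rewrite /borel_lebesgue_step /pushforward preimage_bigcup.
apply: measure_semi_sigma_additive.
- by move=> k; rewrite -[X in measurable X]setTI; exact: measurable_tcons.
- apply/trivIsetP => /= i j _ _ ij; rewrite -preimage_setI.
  by move/trivIsetP : tF => /(_ _ _ _ _ ij) ->//; rewrite preimage_set0.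
- by rewrite -preimage_bigcup -[X in measurable X]setTI; exact: measurable_tcons.
Qed.

HB.instance Definition _ := isMeasure.Build _ _ _ borel_lebesgue_step
  step0 step_ge0 step_sigma_additive.

Let step_sigma_finite : sigma_finite setT borel_lebesgue_step.
Proof.
have [F TF mF] : sigma_finite setT ((@lebesgue_measure R) \x m).
  have /sigma_finiteP[F [TF ndF Foo]] := sigma_finiteT (@lebesgue_measure R).
  have /sigma_finiteP[G [TG ndG Goo]] := sigma_finiteT m.
  exists (fun k => F k `*` G k).
    rewrite -setXTT TF TG predeqE => -[x y]; split.
      move=> [/= [i _ Fix] [j _ Gjy]]; exists (maxn i j) => //; split.
      - by move: x Fix; exact/subsetPset/ndF/leq_maxl.
      - by move: y Gjy; exact/subsetPset/ndG/leq_maxr.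
    by move=> [i _ []/= ? ?]; split; exists i.
  move=> k; have [? ?] := Foo k; have [? ?] := Goo k.
  split; first exact: measurableX.
  by rewrite product_measure1E// lte_mul_pinfty// ge0_fin_numE.
pose psi (t : n.+1.-tuple borelR) : borelR * n.-tuple borelR :=
  (tnth t ord0, [tuple of behead t]).
have mpsi : measurable_fun setT psi.
  by apply: measurable_fun_pair;
    [exact: measurable_tnth|exact: measurable_behead].
have psiK : cancel (@tcons n) psi.
  by move=> [x y]; rewrite /psi; congr (_, _); exact: val_inj.
exists (fun k => psi @^-1` F k).
  by rewrite -preimage_bigcup -TF preimage_setT.
move=> k; have [mFk Fk] := mF k; split.
  by rewrite -[X in measurable X]setTI; exact: mpsi.
rewrite /= /borel_lebesgue_step /pushforward.
suff -> : @tcons n @^-1` (psi @^-1` F k) = F k by [].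
by apply/seteqP; split => z /=; rewrite psiK.
Qed.

HB.instance Definition _ := Measure_isSigmaFinite.Build _ _ _
  borel_lebesgue_step step_sigma_finite.

End Step.

(* The n-fold product of the one-dimensional Lebesgue measure, on the Borel
   sets of R^n. *)
Fixpoint borel_lebesgue (n : nat) : {sigma_finite_measure set (n.-tuple borelR) -> \bar R} :=
  match n with
  | 0%N => \d_([tuple] : 0.-tuple borelR)
  | k.+1 => borel_lebesgue_step (borel_lebesgue k)
  end.

(* R^n equipped with the sigma-algebra of Lebesgue measurable sets, which is
   the Caratheodory sigma-algebra of the outer measure of [borel_lebesgue]. *)
Definition Rn n := caratheodory_type ((borel_lebesgue n)^*)%mu.

HB.instance Definition _ n := Measurable.on (Rn n).

Definition lebesgue n : set (Rn n) -> \bar R :=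
  @completed_measure_extension _ _ _ (borel_lebesgue n).

HB.instance Definition _ n := Measure.on (@lebesgue n).

Definition Rn_coord n (x : Rn n) (i : 'I_n) : R := tnth (x : n.-tuple R) i.

End LebesgueRn.
Arguments Rn : clear implicits.
Arguments lebesgue {R n}.

Section MaximalOperator.
Context {R : realType} {n : nat}.
Local Notation Rn := (Rn R n).
Local Notation mu := (@lebesgue R n).

(* Closed cubes: taking open or half-open ones changes neither the maximal
   function nor the constant below. *)
Definition cube : set (set Rn) :=
  [set Q | exists (a : 'I_n -> R) (l : R), (0 < l)%R /\
     Q = [set x | forall i, (a i <= Rn_coord x i <= a i + l)%R]].

Definition cube_average (Q : set Rn) (g : Rn -> \bar R) : \bar R :=
  (mu Q)^-1 * \int[mu]_(y in Q) g y.

Definition cube_maximal (f : Rn -> R) (x : Rn) : \bar R :=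
  ereal_sup [set cube_average Q (fun y => `|f y|%:E) * (\1_Q x)%:E | Q in cube].

Definition weakLp_norm (p : R) (g : Rn -> \bar R) : \bar R :=
  ereal_sup [set l%:E * mu [set x | l%:E < `|g x|] `^ p^-1
            | l in [set l : R | (0 < l)%R]].

Definition weight (w : Rn -> R) : Prop :=
  measurable_fun [set: Rn] w /\ {ae mu, forall x, (0 <= w x)%R}.

Definition Lp_weight_norm (p : R) (w f : Rn -> R) : \bar R :=
  (\int[mu]_x (`|f x| `^ p * w x)%:E) `^ p^-1.

Definition Lp_weight (p : R) (w : Rn -> R) : set (Rn -> R) :=
  [set f | measurable_fun [set: Rn] f /\ Lp_weight_norm p w f < +oo].

Definition conj_exp (p : R) : R := (p / (p - 1))%R.

(* w^(1-p'); [powR] sends 0 to 0 for a negative exponent, hence the case distinction. *)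
Definition dual_weight (p : R) (w : Rn -> R) (x : Rn) : \bar R :=
  if w x == 0%R then +oo else (w x `^ (1 - conj_exp p))%:E.

Definition Apstar_const (p : R) (w : Rn -> R) : \bar R :=
  ereal_sup [set (mu Q)^-1 * weakLp_norm 1 (fun x => (w x * \1_Q x)%:E)
                 * cube_average Q (dual_weight p w) `^ (p - 1) | Q in cube].

Definition Apstar (p : R) (w : Rn -> R) : Prop := Apstar_const p w < +oo.

End MaximalOperator.

(* Main.v *)
Require Import Defs.
From mathcomp Require Import all_boot all_order all_algebra.
From mathcomp Require Import all_classical all_reals all_analysis.
From mathcomp Require Import measurable_realfun ring lra.
Import Order.TTheory GRing.Theory Num.Theory.
Import numFieldNormedType.Exports.
Set Implicit Arguments.
Unset Strict Implicit.
Unset Printing Implicit Defensive.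
Local Open Scope classical_set_scope.
Local Open Scope ring_scope.
Local Open Scope ereal_scope.

(* Write sigma = w^(1-p').
   (i) => (ii): test the inequality on f = sigma chi_Q, with w replaced by
   max(w, 0) + 1/(k+1) to keep f bounded, and let k tend to infinity.
   (ii) => (i): by A_p^*, the set where w exceeds a large multiple of
   (avg_Q sigma)^(1-p) is a small part of Q; equivalently sigma is at least a
   fixed multiple of its average on most of Q, so sigma is doubling and sets of
   large relative Lebesgue measure in Q carry a fixed proportion of sigma(Q).
   For a finite family of cubes, first triple each cube as long as its average
   of f increases. Then run through the cubes by decreasing size, dropping Q if
   it meets a selected cube with comparable or larger average. A dropped cube
   lies in the triple of the cube that caused it to be dropped, while by Vitali
   the smaller selected cubes meeting a selected Q cover at most half of Q. With
   the weak-norm bound on the triples, the level set {w (Mf)^p > t} has measure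
   at most C/t times the sum of (int_Q f / sigma(Q))^p sigma(Q) over the
   selected cubes. These are sparse for sigma, hence the sum is bounded by the
   integral of f^p w through the weak (1,1) inequality for the sigma-maximal
   function and a layer-cake decomposition. *)

(** * Covering lemmas *)

(** Run through the indices by decreasing [r] and keep one unless an index already kept blocks it.
    Taking [blk] to be intersection gives the Vitali selection; adding a comparison of averages
    gives the sparse one. *)
Lemma greedy_selection (R : realType) (I : eqType) (r : I -> R) (blk : rel I)
    (s : seq I) :
  exists S : seq I, [/\ {subset S <= s},
    pairwise (fun i j => (r j <= r i)%R && ~~ blk i j) S &
    forall i, i \in s ->
      i \in S \/ exists j, [/\ j \in S, (r i <= r j)%R & blk j i]].
Proof.
pose e : rel I := fun i j => (r j <= r i)%R.
have eT : total e by move=> i j; exact: le_total.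
have etr : transitive e by move=> j i k ij jk; exact: le_trans jk ij.
suff: forall u, pairwise e u -> exists S : seq I, [/\ {subset S <= u},
    pairwise (fun i j => (r j <= r i)%R && ~~ blk i j) S &
    forall i, i \in u ->
      i \in S \/ exists j, [/\ j \in S, (r i <= r j)%R & blk j i]].
  move=> /(_ (sort e s)); rewrite -sorted_pairwise// => /(_ (sort_sorted eT s)).
  move=> [S [Ss pS cS]]; exists S; split=> //.
    by move=> i /Ss; rewrite mem_sort.
  by move=> i si; apply: cS; rewrite mem_sort.
(* In a list with [r] decreasing, the appended index is the smallest, so whatever blocks it is at
   least as large. *)
elim/last_ind => [_|u i IH]; first by exists [::].
rewrite pairwise_rcons => /andP[/allP ui /IH[S [Su pS cS]]].
have [/hasP[j jS bji]|nb] := boolP (has (fun j => blk j i) S).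
  exists S; split=> // [k /Su ku|k]; first by rewrite mem_rcons inE ku orbT.
  rewrite mem_rcons inE => /orP[/eqP->|/cS//].
  by right; exists j; split=> //; apply: ui; exact: Su.
exists (rcons S i); split=> [k||k].
- by rewrite !mem_rcons !inE => /orP[->//|/Su ->]; rewrite orbT.
- rewrite pairwise_rcons pS andbT; apply/allP => j jS.
  rewrite (ui j (Su _ jS) : (r i <= r j)%R) /=; apply: contra nb => bji.
  by apply/hasP; exists j.
- rewrite !mem_rcons !inE => /orP[->|/cS[->|[j [jS rj bj]]]]; first by left.
    by left; rewrite orbT.
  by right; exists j; split=> //; rewrite mem_rcons inE jS orbT.
Qed.

Section MeasureFacts.
Context d (X : measurableType d) (R : realType) (mu : {measure set X -> \bar R}).

Lemma measurable_gt_set (w : X -> R) (t : R) :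
  measurable_fun setT w -> measurable [set x | (t < w x)%R].
Proof.
move=> mw; have /(_ measurableT `]t, +oo[%classic) := mw.
rewrite setTI => /(_ (measurable_itv _)); congr measurable.
by apply/seteqP; split => x /=; rewrite in_itv/= andbT.
Qed.

Lemma measurable_lt_set (t : R) (w : X -> R) :
  measurable_fun setT w -> measurable [set x | (w x < t)%R].
Proof.
move=> mw; have -> : [set x | (w x < t)%R] = [set x | (- t < - w x)%R].
  by apply/seteqP; split => x /=; rewrite ltrN2.
apply: measurable_gt_set; exact: measurableT_comp mw.
Qed.

Lemma measurable_gt_scaled_set (w : X -> R) (t G : R) :
  measurable_fun setT w -> measurable [set x | (t < w x * G)%R].
Proof.
move=> mw; apply: (measurable_gt_set (w := fun x => w x * G)%R).
exact: measurable_funM.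
Qed.

Lemma measurable_gt_norm_indic_set (w : X -> R) (Q : set X) (t : R) :
  measurable_fun setT w -> measurable Q ->
  measurable [set x | (t < `|w x * \1_Q x|)%R].
Proof.
move=> mw mQ; apply: (measurable_gt_set (w := fun x => `|w x * \1_Q x|)%R).
by apply: measurableT_comp => //; apply: measurable_funM.
Qed.

Lemma integral_gt0 (D : set X) (f : X -> \bar R) :
  measurable D -> measurable_fun D f -> 0 < mu D ->
  (forall x, D x -> 0 < f x) -> 0 < \int[mu]_(x in D) f x.
Proof.
move=> mD mf D0 f0.
have i0 : 0 <= \int[mu]_(x in D) f x by apply: integral_ge0 => x /f0/ltW.
rewrite lt_neqAle i0 andbT eq_sym; apply: contraTneq D0 => fD0.
rewrite -leNgt.
have /(ae_eq_integral_abs _ mD mf)[N [mN N0 DN]] :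
    \int[mu]_(x in D) `|f x| = 0.
  by rewrite -fD0; apply: eq_integral => x /[!inE] /f0/ltW/gee0_abs.
rewrite -N0; apply: le_measure; rewrite ?inE// => x Dx.
by apply: DN => /= /(_ Dx) fx0; have := f0 _ Dx; rewrite fx0 ltxx.
Qed.

End MeasureFacts.

(** * Integrals over finite unions *)

Section FiniteUnions.
Context d (X : measurableType d) (R : realType) (mu : {measure set X -> \bar R}).
Context (I : choiceType) (Q : I -> set X).
Hypothesis mQ : forall i, measurable (Q i).

Lemma bigsetUP (s : seq I) (P : pred I) x :
  (\big[setU/set0]_(i <- s | P i) Q i) x <-> exists2 i, i \in s & P i /\ Q i x.
Proof.
elim: s => [|i s IH]; first by rewrite big_nil; split=> // -[].
rewrite big_cons; case: ifPn => Pi.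
  split=> [[Qix|/IH[j js Qjx]]|[j]].
  - by exists i; rewrite ?mem_head.
  - by exists j => //; rewrite inE js orbT.
  - rewrite inE => /orP[/eqP->|js] [Pj Qjx]; first by left.
    by right; apply/IH; exists j.
split=> [/IH[j js Qjx]|[j]]; first by exists j => //; rewrite inE js orbT.
rewrite inE => /orP[/eqP->|js] [Pj Qjx]; first by rewrite Pj in Pi.
by apply/IH; exists j.
Qed.

Variable h : X -> \bar R.
Hypotheses (mh : measurable_fun setT h) (h0 : forall x, 0 <= h x).

Let mhD D : measurable_fun D h.
Proof. exact: measurable_funS mh. Qed.

Lemma integral_setU_le (A B : set X) : measurable A -> measurable B ->
  \int[mu]_(x in A `|` B) h x <= \int[mu]_(x in A) h x + \int[mu]_(x in B) h x.
Proof.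
move=> mA mB; rewrite -[A `|` B](setDUK (@subsetUl _ A B)).
have mD : measurable ((A `|` B) `\` A) by apply: measurableD => //; exact: measurableU.
rewrite ge0_integral_setU//; last by apply/disj_setPS => x [? []].
apply: leeD => //; apply: ge0_subset_integral => //.
by move=> x [[]].
Qed.

Lemma integral_bigsetU_le (s : seq I) (P : pred I) :
  \int[mu]_(x in \big[setU/set0]_(i <- s | P i) Q i) h x <=
  \sum_(i <- s | P i) \int[mu]_(x in Q i) h x.
Proof.
elim: s => [|i s IH]; first by rewrite !big_nil integral_set0.
rewrite !big_cons; case: ifPn => // Pi.
apply: (le_trans (integral_setU_le _ _)) => //.
  exact: bigsetU_measurable.
exact: leeD.
Qed.

Lemma integral_bigsetU_disjoint (s : seq I) :
  pairwise (fun i j => `[< Q i `&` Q j = set0 >]) s ->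
  \int[mu]_(x in \big[setU/set0]_(i <- s) Q i) h x =
  \sum_(i <- s) \int[mu]_(x in Q i) h x.
Proof.
elim: s => [|i s IH]; first by rewrite !big_nil integral_set0.
rewrite pairwise_cons => /andP[/allP si /IH {}IH]; rewrite !big_cons -IH.
apply: ge0_integral_setU => //; first exact: bigsetU_measurable.
apply/disj_setPS => x [Qix /bigsetUP[j /si/asboolP ij [_ Qjx]]].
by rewrite -ij.
Qed.

End FiniteUnions.

(** * The weak-type inequality for finite families of cubes *)

Section GeometricLevels.
Context (R : realType) (p c0 : R).
Hypotheses (p_gt1 : (1 < p)%R) (c0_gt0 : (0 < c0)%R).

(* The ratio of the levels is chosen so that the (p-1)-st powers double. *)
Definition level (l : nat) : R := (c0 * (2 `^ (p - 1)^-1) ^+ l)%R.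

Let p1_gt0 : (0 < p - 1)%R. Proof. by rewrite subr_gt0. Qed.

Lemma level_gt0 l : (0 < level l)%R.
Proof. by rewrite mulr_gt0// exprn_gt0// powR_gt0. Qed.

Lemma level_powR l : (level l `^ (p - 1) = c0 `^ (p - 1) * 2 ^+ l)%R.
Proof.
rewrite powRM ?ltW// ?exprn_gt0 ?powR_gt0//; congr *%R.
rewrite -powR_mulrn ?powR_ge0// -powRrM -powRrM mulrCA mulVf ?gt_eqF//.
by rewrite mulr1 powR_mulrn.
Qed.

(** The (p-1)-st powers of the levels form a geometric progression of ratio 2, so the sum is at most
    twice its last term, whose level is below [y]. *)
Lemma level_sum (N : nat) (y : R) : (0 <= y)%R ->
  (\sum_(l < N | (level l < y)%R) level l `^ (p - 1) <= 2 * y `^ (p - 1))%R.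
Proof.
move=> y0; elim: N => [|N IH]; first by rewrite big_ord0 mulr_ge0 ?powR_ge0.
have [Ny|Ny] := ltP (level N) y; last first.
  by rewrite big_mkcond big_ord_recr/= ltNge Ny addr0 -big_mkcond.
apply: (@le_trans _ _ (\sum_(l < N.+1) level l `^ (p - 1))%R).
  rewrite big_mkcond; apply: ler_sum => l _.
  by case: ifP; rewrite // powR_ge0.
apply: (@le_trans _ _ (2 * level N `^ (p - 1))%R); last first.
  rewrite ler_pM2l//.
  by rewrite ge0_ler_powR ?nnegrE ?(ltW p1_gt0) ?(ltW (level_gt0 N))// ltW.
under eq_bigr do rewrite level_powR.
rewrite -mulr_sumr level_powR mulrCA ler_pM2l ?powR_gt0// -exprS.
have two1 : (2 - 1 = 1 :> R)%R by ring.
by have := subrX1 (2 : R)%R N.+1; rewrite two1 mul1r => <-; rewrite lerBlDr lerDl.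
Qed.

(** Discrete layer cake: [A] lies between two consecutive levels [l] and [l.+1], and the single term
    of index [l] already dominates. *)
Lemma level_bracket (N : nat) (A : R) : (c0 < A)%R -> (A <= level N)%R ->
  (A `^ p <= \sum_(l < N | (level l < A)%R) level l.+1 `^ p)%R.
Proof.
move=> cA AN; have p0 : (0 <= p)%R by rewrite ltW// (lt_trans ltr01).
have [l [lN lA Al]] : exists l, [/\ (l < N)%N, (level l < A)%R & (A <= level l.+1)%R].
  elim: N AN => [|N IH AN]; first by rewrite /level expr0 mulr1 leNgt cA.
  have [NA|NA] := ltP (level N) A; first by exists N.
  by have [l [lN ? ?]] := IH NA; exists l; split=> //; exact: ltnW.
apply: (@le_trans _ _ (level l.+1 `^ p)%R).
  by rewrite ge0_ler_powR ?nnegrE ?(ltW (level_gt0 _)) ?(ltW (lt_trans c0_gt0 cA)).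
rewrite (bigD1 (Ordinal lN))//= lerDl; apply: sumr_ge0 => i _.
exact: powR_ge0.
Qed.

Lemma level_ubound (I : eqType) (A : I -> R) (s : seq I) :
  exists N, forall i, i \in s -> (A i <= level N)%R.
Proof.
pose M := (\sum_(i <- s) `|A i|)%R.
have M0 : (0 <= M)%R by exact: sumr_ge0.
(* Since N < 2^N, this makes the (p-1)-st power of [level N] at least that of [M]. *)
pose N := Num.bound (M `^ (p - 1) / c0 `^ (p - 1))%R.
exists N => i si; apply: (@le_trans _ _ M).
  apply: (le_trans (ler_norm _)); rewrite /M (big_rem i)//= lerDl.
  exact: sumr_ge0.
have : (M `^ (p - 1) <= level N `^ (p - 1))%R.
  rewrite level_powR mulrC -ler_pdivrMr ?powR_gt0//.
  have := archi_boundP (divr_ge0 (powR_ge0 M (p - 1)) (powR_ge0 c0 (p - 1))).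
  move=> /ltW/le_trans; apply; rewrite -natrX ler_nat.
  exact/ltnW/ltn_expl.
apply: contraTT; rewrite -!ltNge => lM.
by rewrite gt0_ltr_powR ?nnegrE// ltW// level_gt0.
Qed.

End GeometricLevels.

Lemma seq_positive_lower_bound (R : realType) (I : eqType) (A : I -> R)
    (s : seq I) : (forall i, i \in s -> (0 < A i)%R) ->
  exists2 c, (0 < c)%R & forall i, i \in s -> (c < A i)%R.
Proof.
elim: s => [_|i s IH si]; first by exists 1%R.
have [j js|c c0 cs] := IH; first by apply: si; rewrite inE js orbT.
have i0 : (0 < A i)%R by apply: si; rewrite mem_head.
exists (Num.min c (A i / 2))%R; first by rewrite lt_min c0 divr_gt0.
move=> j; rewrite inE gt_min => /orP[/eqP->|/cs->//].
by rewrite ltr_pdivrMr// ltr_pMr// ltr1n orbT.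
Qed.

(* The cubes enter only through an index type: [T i] is the triple of the cube
   [i], [r i] its size and [v i] its volume; [S i] below is sigma of the cube. *)
Section CoveringFamily.
Context d (X : measurableType d) (R : realType) (mu : {measure set X -> \bar R}).
Context (I : choiceType) (Q : I -> set X) (T : I -> I) (r v : I -> R) (L : R).
Hypotheses (mQ : forall i, measurable (Q i))
  (muQ : forall i, mu (Q i) = (v i)%:E) (v_gt0 : forall i, (0 < v i)%R)
  (vT : forall i, v (T i) = (L * v i)%R) (L_gt1 : (1 < L)%R)
  (QT : forall i, Q i `<=` Q (T i))
  (meetT : forall i j, Q i `&` Q j !=set0 -> (r j <= r i)%R -> Q j `<=` Q (T i)).

(** Weak (1,1) inequality for the maximal function with respect to the doubling density [h]: the
    triples of a disjoint subfamily cover the union, doubling returns to the cubes themselves, and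
    the integrals of [phi] over disjoint cubes add up. It is used with [h] equal to 1 and to
    sigma. *)
Lemma vitali_weak_type (h phi : X -> \bar R) (c D : R) (s : seq I) (P : pred I)
    (U : set X) :
  measurable_fun setT h -> (forall x, 0 <= h x) ->
  measurable_fun setT phi -> (forall x, 0 <= phi x) ->
  (0 <= c)%R -> (0 <= D)%R ->
  (forall i, \int[mu]_(x in Q (T i)) h x <= D%:E * \int[mu]_(x in Q i) h x) ->
  measurable U ->
  (forall i, i \in s -> P i -> Q i `<=` U /\
     c%:E * \int[mu]_(x in Q i) h x <= \int[mu]_(x in Q i) phi x) ->
  c%:E * \int[mu]_(x in \big[setU/set0]_(i <- s | P i) Q i) h x <=
  D%:E * \int[mu]_(x in U) phi x.
Proof.
move=> mh h0 mphi phi0 c0 D0 hD mU hs.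
have [S [Ss pS cS]] := greedy_selection r
  (fun i j => `[< Q i `&` Q j !=set0 >]) [seq i <- s | P i].
have QS : \big[setU/set0]_(i <- s | P i) Q i `<=`
    \big[setU/set0]_(i <- S) Q (T i).
  move=> x /bigsetUP[i si [Pi Qix]]; apply/(bigsetUP (fun i => Q (T i))).
  have /cS[iS|[j [jS rij /asboolP bji]]] : i \in [seq i <- s | P i].
    by rewrite mem_filter Pi.
  - by exists i => //; split=> //; exact: QT.
  - by exists j => //; split=> //; exact: meetT bji rij _ _.
have sub i : i \in S -> Q i `<=` U /\
    c%:E * \int[mu]_(x in Q i) h x <= \int[mu]_(x in Q i) phi x.
  by move=> /Ss; rewrite mem_filter => /andP[Pi si]; exact: hs.
have mh' A : measurable_fun A h by exact: measurable_funS mh.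
have mphi' A : measurable_fun A phi by exact: measurable_funS mphi.
have h0' A : 0 <= \int[mu]_(x in A) h x by exact: integral_ge0.
apply: (@le_trans _ _ (c%:E * \sum_(i <- S) \int[mu]_(x in Q (T i)) h x)).
  apply: lee_wpmul2l; rewrite ?lee_fin//.
  apply: (le_trans (ge0_subset_integral _ _ _ _ _ QS)) => //.
  - exact: bigsetU_measurable.
  - exact: bigsetU_measurable.
  - exact: (integral_bigsetU_le _ (Q := fun i => Q (T i))).
apply: (@le_trans _ _ (\sum_(i <- S) (D%:E * \int[mu]_(x in Q i) phi x))).
  rewrite ge0_sume_distrr//; rewrite big_seq [leRHS]big_seq; apply: lee_sum => i iS.
  have [_ ci] := sub _ iS.
  apply: (@le_trans _ _ (D%:E * (c%:E * \int[mu]_(x in Q i) h x))).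
    by rewrite muleCA; apply: lee_wpmul2l; rewrite ?lee_fin//.
  by apply: lee_wpmul2l; rewrite ?lee_fin.
rewrite -ge0_sume_distrr; last by move=> i _; exact: integral_ge0.
rewrite -integral_bigsetU_disjoint//; last first.
  apply: sub_pairwise pS => i j /andP[_ /asboolPn ij]; apply/asboolP.
  by apply/eqP; apply: contra_notT ij => /set0P.
apply: lee_wpmul2l; rewrite ?lee_fin//.
apply: ge0_subset_integral => //; first exact: bigsetU_measurable.
by move=> x /bigsetUP[i /sub[QU _] [_ /QU]].
Qed.

Context (w : X -> R) (p : R) (S : I -> R) (K : R).
Hypotheses (mw : measurable_fun setT w) (w_gt0 : forall x, (0 < w x)%R)
  (p_gt1 : (1 < p)%R).
(** This is sigma, because 1 - p' = -1/(p - 1). The hypothesis [hK] below is the A_p^* condition on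
    one cube, with the weak norm spelled out as a bound on each superlevel set of [w]. *)
Let sg x : R := w x `^ (- (p - 1)^-1).
Hypotheses (hS : forall i, \int[mu]_(x in Q i) (sg x)%:E = (S i)%:E)
  (K_gt0 : (0 < K)%R)
  (hK : forall i t, (0 < t)%R -> mu (Q i `&` [set x | (t < w x)%R]) <=
     (K * v i / t * (S i / v i) `^ (1 - p))%:E).

Let p1_gt0 : (0 < p - 1)%R. Proof. by rewrite subr_gt0. Qed.
Let sg_gt0 x : (0 < sg x)%R. Proof. exact: powR_gt0. Qed.
Let msg D : measurable_fun D sg.
Proof.
by apply: measurable_funTS; exact: measurableT_comp (measurable_powR _) mw.
Qed.
Let mEsg D : measurable_fun D (EFin \o sg).
Proof. exact/measurable_EFinP. Qed.

Lemma dual_mass_gt0 i : (0 < S i)%R.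
Proof.
rewrite -lte_fin -hS; apply: integral_gt0 => //.
- by rewrite muQ lte_fin.
- by move=> x _; rewrite lte_fin.
Qed.

Let mwt t : measurable [set x | (t < w x)%R].
Proof. exact: measurable_gt_set. Qed.

(** An A-infinity property of sigma. Outside a set of measure at most half that of [E], [w] is at
    most a multiple of (avg sigma)^(1-p), so sigma is at least [b] times its average there. *)
Lemma dual_weight_ainfty (dlt : R) : (0 < dlt)%R -> exists2 c : R, (0 < c)%R &
  forall i E, measurable E -> E `<=` Q i -> (dlt * v i)%:E <= mu E ->
    (c * S i)%:E <= \int[mu]_(x in E) (sg x)%:E.
Proof.
move=> d0; pose b := ((2 * K / dlt) `^ (- (p - 1)^-1))%R.
have b0 : (0 < b)%R by rewrite powR_gt0// !mulr_gt0 ?invr_gt0.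
exists (b * dlt / 2)%R; first by rewrite !mulr_gt0// invr_gt0.
move=> i E mE EQ dE.
have Sv0 : (0 < S i / v i)%R by rewrite divr_gt0// dual_mass_gt0.
(* At this height [hK] bounds the part of the cube where w > t by [dlt * v i / 2], and the
   corresponding value of sigma is [b] times its average. *)
pose t := (2 * K / dlt * (S i / v i) `^ (1 - p))%R.
have t0 : (0 < t)%R by rewrite !mulr_gt0 ?invr_gt0 ?powR_gt0.
have tE : (t `^ (- (p - 1)^-1) = b * (S i / v i))%R.
  rewrite /t powRM ?powR_ge0//; last by rewrite !mulr_ge0// ?invr_ge0 ltW.
  congr *%R; rewrite -powRrM -(opprB p) mulrNN divff ?gt_eqF// powRr1//.
  exact: ltW.
pose W := [set x | (t < w x)%R].
have mW : measurable W by exact: mwt.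
have EWfin : mu (E `&` W) <= (dlt * v i / 2)%:E.
  apply: (@le_trans _ _ (mu (Q i `&` W))).
    apply: le_measure; rewrite ?inE; [exact: measurableI|exact: measurableI|].
    exact: setSI.
  apply: (le_trans (hK i t0)); rewrite lee_fin le_eqVlt; apply/orP; left; apply/eqP.
  rewrite /t; field.
  by rewrite !gt_eqF// powR_gt0.
have EWD : (dlt * v i / 2)%:E <= mu (E `\` W).
  have : (dlt * v i)%:E <= mu (E `&` W) + mu (E `\` W).
    rewrite -measureU; [|exact: measurableI|exact: measurableD|].
      by rewrite setUIDK.
    by apply/seteqP; split => x // [[_ Wx] [_]].
  move: EWfin; case: (mu (E `&` W)) => [a| |]; case: (mu (E `\` W)) => [b'| |] //.
    by rewrite -EFinD !lee_fin => *; lra.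
  by move=> _ _; exact: leey.
apply: (@le_trans _ _ (\int[mu]_(x in E `\` W) (t `^ (- (p - 1)^-1))%:E)).
  rewrite integral_cst//; last exact: measurableD.
  rewrite tE; apply: (@le_trans _ _ ((b * (S i / v i))%:E * (dlt * v i / 2)%:E)).
    rewrite -EFinM lee_fin le_eqVlt; apply/orP; left; apply/eqP.
    by field; rewrite gt_eqF.
  by apply: lee_wpmul2l => //; rewrite lee_fin mulr_ge0 // ltW.
apply: (@le_trans _ _ (\int[mu]_(x in E `\` W) (sg x)%:E)).
  apply: ge0_le_integral.
  - exact: measurableD.
  - by move=> x _; rewrite lee_fin powR_ge0.
  - exact: measurable_cst.
  - exact: mEsg.
  - move=> x [_ /negP]; rewrite -leNgt => wt; rewrite lee_fin /sg !powRN.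
    rewrite lef_pV2 ?posrE ?powR_gt0//.
    by rewrite ge0_ler_powR ?nnegrE ?invr_ge0 ?(ltW t0) ?(ltW p1_gt0)// ltW.
apply: ge0_subset_integral => //; first exact: measurableD.
by move=> x _; rewrite lee_fin powR_ge0.
Qed.


Context (f : X -> R) (F : I -> R).
Hypotheses (mf : measurable_fun setT f) (f_ge0 : forall x, (0 <= f x)%R)
  (hF : forall i, \int[mu]_(x in Q i) (f x)%:E = (F i)%:E).

Let mEf D : measurable_fun D (EFin \o f).
Proof. by apply/measurable_EFinP; exact: measurable_funTS. Qed.

Let F_ge0 i : (0 <= F i)%R.
Proof. by rewrite -lee_fin -hF integral_ge0// => x _; rewrite lee_fin. Qed.

Let L_gt0 : (0 < L)%R. Proof. exact: lt_trans L_gt1. Qed.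

(** The last clause is a Carleson packing condition. It is stated for every subfamily because it is
    applied to the cubes whose ratio [F i / S i] exceeds a given level. *)
Definition sparse_selection (c : R) (s S' : seq I) : Prop :=
  [/\ {subset S' <= s},
    forall i, i \in s -> exists j, [/\ j \in S', Q i `<=` Q (T j) &
       (F i / v i <= 2 * L ^+ 2 * (F j / v j))%R] &
    forall P : pred I, (c * \sum_(i <- S' | P i) S i)%:E <=
       \int[mu]_(x in \big[setU/set0]_(i <- S' | P i) Q i) (sg x)%:E].

(** Packing is proved by peeling off the largest selected cube. A smaller selected cube meeting it
    was kept only because its average of [f] is more than [a] times larger, so by Vitali such cubes
    cover at most half of the large one, and the rest carries the proportion [c] of its
    sigma-mass. *)
Lemma exists_sparse_selection (c : R) (s : seq I) : (0 < c)%R ->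
  (forall i E, measurable E -> E `<=` Q i -> (2^-1 * v i)%:E <= mu E ->
    (c * S i)%:E <= \int[mu]_(x in E) (sg x)%:E) ->
  (forall i, i \in s -> (0 < F i)%R /\ (F (T i) <= L * F i)%R) ->
  exists S', sparse_selection c s S'.
Proof.
move=> c0 hc Fs; pose a : R := (2 * L ^+ 2)%R.
have a1 : (1 <= a)%R.
  have L2 : (1 <= L ^+ 2)%R by rewrite exprn_ege1// ltW.
  by rewrite /a; lra.
have a0 : (0 < a)%R by exact: lt_le_trans a1.
have [S' [Ss pS cS]] := greedy_selection r
  (fun i j => `[< Q i `&` Q j !=set0 >] && (F j / v j <= a * (F i / v i))%R) s.
have avg0 i : (0 <= F i / v i)%R by rewrite divr_ge0// ltW.
exists S'; split=> // [i /cS[iS|[j [jS rij /andP[/asboolP ji Fij]]]]|P].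
- by exists i; split=> //; rewrite -/a ler_peMl.
- by exists j; split=> //; exact: meetT ji rij.
have : forall i, i \in S' -> (0 < F i)%R /\ (F (T i) <= L * F i)%R by move=> i /Ss/Fs.
elim: S' {Ss cS} pS => [_ _|i S' IH].
  by rewrite !big_nil mulr0 integral_set0.
rewrite pairwise_cons => /andP[/allP iS pS] FS; rewrite !big_cons.
have {}IH := IH pS (fun j jS => FS j (mem_behead (s := i :: S') jS)).
case: ifPn => // Pi.
set U := \big[setU/set0]_(j <- S' | P j) Q j in IH *.
have mU : measurable U by exact: bigsetU_measurable.
pose B := \big[setU/set0]_(j <- S' | `[< Q i `&` Q j !=set0 >]) Q j.
have mB : measurable B by exact: bigsetU_measurable.
have [Fi0 FTi] := FS i (mem_head _ _).
have muB : mu B <= (2^-1 * v i)%:E.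
  have := @vitali_weak_type (cst 1) (EFin \o f) (a * (F i / v i)) L S'
    (fun j => `[< Q i `&` Q j !=set0 >]) (Q (T i)).
  rewrite integral_cst// hF mul1e -/B -EFinM.
  (* One factor [L] is the Lebesgue doubling constant in the Vitali bound, the other comes from
     [F (T i) <= L * F i]; the choice a = 2 L^2 leaves one half. *)
  have -> : (2^-1 * v i)%:E = (a * (F i / v i))^-1%:E * (L * (L * F i))%:E.
    rewrite -EFinM; congr EFin; rewrite /a; field.
    by rewrite !gt_eqF.
  move=> vwt; rewrite -[leLHS]mul1e -(@mulVf _ (a * (F i / v i))%R); last first.
    by rewrite gt_eqF// mulr_gt0 ?divr_gt0.
  rewrite EFinM -muleA; apply: lee_wpmul2l.
    by rewrite lee_fin invr_ge0 mulr_ge0 ?(ltW a0).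
  apply: le_trans (vwt _ _ _ _ _ _ _ _ _) _ => //.
  - by rewrite mulr_ge0 ?(ltW a0).
  - exact: ltW.
  - by move=> j; rewrite !integral_cst// !mul1e !muQ vT EFinM.
  - move=> j jS /asboolP ij; have /andP[rji] := iS _ jS.
    rewrite negb_and => /orP[/asboolPn//|]; rewrite -ltNge => Fij.
    split; first exact: meetT ij rji.
    rewrite integral_cst// mul1e muQ hF -EFinM lee_fin -ler_pdivlMr//.
    exact: ltW.
  - by rewrite lee_fin ler_pM2l.
have EQ : Q i `|` U = (Q i `\` U) `|` U by rewrite setUC setUDl setDv setD0 setUC.
rewrite EQ ge0_integral_setU//; last 3 first.
- exact: measurableD.
- by move=> x _; rewrite lee_fin ltW.
- by apply/disj_setPS => x [[]].
rewrite mulrDr EFinD; apply: leeD => //.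
apply: hc; [exact: measurableD|exact: subDsetl|].
(* A point of [Q i] in [U] lies in a selected cube meeting [Q i], hence in [B]; so at least half of
   [Q i] avoids [U]. *)
have : mu (Q i) <= mu (Q i `\` U) + mu B.
  apply: le_trans (measureU2 _ _ _) => //; last exact: measurableD.
  apply: le_measure; rewrite ?inE//.
    by apply: measurableU => //; exact: measurableD.
  move=> x Qix; have [/bigsetUP[j jS [Pj Qjx]]|nUx] := pselect (U x); last by left.
  right; apply/bigsetUP; exists j => //; split=> //; apply/asboolP.
  by exists x.
rewrite muQ; move: muB; case: (mu (Q i `\` U)) => [y| |]; case: (mu B) => [z| |] //.
  by rewrite -EFinD !lee_fin => *; lra.
by move=> _ _; exact: leey.
Qed.


(* At level [s] only the part of [f] above [s sigma / 2] matters, as in the proof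
   of the Marcinkiewicz interpolation theorem. *)
Let big_part (s : R) (x : X) : R := (f x * \1_[set x | (s * sg x < 2 * f x)%R] x)%R.

Let measurable_big_part s : measurable_fun setT (big_part s).
Proof.
apply: measurable_funM => //; apply: measurable_indic.
have -> : [set x | (s * sg x < 2 * f x)%R] = [set x | (0 < 2 * f x - s * sg x)%R].
  by apply/seteqP; split => x /=; rewrite subr_gt0.
by apply: measurable_gt_set; apply: measurable_funB; exact: measurable_funM.
Qed.

Let big_part_ge0 s x : (0 <= big_part s x)%R.
Proof. by rewrite mulr_ge0// indicE. Qed.

Let big_partE s x : big_part s x = if (s * sg x < 2 * f x)%R then f x else 0%R.
Proof.
rewrite /big_part indicE; case: ifPn => h; first by rewrite mem_set ?mulr1.
by rewrite memNset ?mulr0//; exact/negP.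
Qed.

(** * Carleson embedding for a sparse family *)

Section CarlesonEmbedding.
Context (c D : R) (S' : seq I).
Hypotheses (c_gt0 : (0 < c)%R) (D_gt0 : (0 < D)%R)
  (doubling : forall i, (S (T i) <= D * S i)%R)
  (F_gt0 : forall i, i \in S' -> (0 < F i)%R)
  (sparse : forall P : pred I, (c * \sum_(i <- S' | P i) S i)%:E <=
     \int[mu]_(x in \big[setU/set0]_(i <- S' | P i) Q i) (sg x)%:E).

(** On a cube where [F i / S i] exceeds [s], the part of [f] below s sigma / 2 contributes at most
    half of [s * S i], so [big_part s] still has sigma-average at least s / 2. Packing and the weak
    (1,1) inequality for sigma then apply. *)
Lemma carleson_level (s : R) : (0 < s)%R ->
  (s / 2 * (c * \sum_(i <- S' | (s < F i / S i)%R) S i))%:E <=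
  D%:E * \int[mu]_x (big_part s x)%:E.
Proof.
move=> s0; rewrite EFinM.
apply: (le_trans (lee_wpmul2l _ (sparse _))); first by rewrite lee_fin divr_ge0// ltW.
apply: vitali_weak_type => //.
- by move=> x; rewrite lee_fin ltW.
- exact/measurable_EFinP.
- by move=> x; rewrite lee_fin.
- by rewrite divr_ge0// ltW.
- exact: ltW.
- by move=> i; rewrite !hS -EFinM lee_fin.
move=> i iS; rewrite ltr_pdivlMr ?dual_mass_gt0// => sFi; split=> //.
have : (F i)%:E <= \int[mu]_(x in Q i) (big_part s x)%:E + (s / 2)%:E * (S i)%:E.
  have mbp A : measurable_fun A (EFin \o big_part s).
    by apply/measurable_EFinP; exact: measurable_funTS.
  have msgs A : measurable_fun A (fun x => (s / 2)%:E * (sg x)%:E).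
    by apply: emeasurable_funM; [exact: measurable_cst|exact: mEsg].
  rewrite -hF -hS -ge0_integralZl//; last 2 first.
  - by move=> x _; rewrite lee_fin ltW.
  - by rewrite lee_fin divr_ge0// ltW.
  rewrite -ge0_integralD//.
  - apply: ge0_le_integral => //.
    + by move=> x _; rewrite lee_fin.
    + by apply: emeasurable_funD; [exact: mbp|exact: msgs].
    move=> x _; rewrite -EFinM -EFinD lee_fin big_partE; case: ltP => [_|?]; last lra.
    by rewrite lerDl mulr_ge0 ?divr_ge0// ltW.
  - by move=> x _; rewrite lee_fin.
  - by move=> x _; rewrite -EFinM lee_fin mulr_ge0 ?divr_ge0// ltW.
rewrite hS; case: (\int[mu]_(x in Q i) _) => [y| |//].
  by rewrite -EFinM -EFinD !lee_fin => *; lra.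
by move=> _; exact: leey.
Qed.

(** At a fixed point only the levels below y = 2 f / sigma contribute. [level_sum] bounds their sum
    by 2 y^(p-1), and sigma^(1-p) = w turns f y^(p-1) into a multiple of f^p w. *)
Let big_part_levels (c0 : R) (N : nat) (x : X) : (0 < c0)%R ->
  (\sum_(l < N) level p c0 l `^ (p - 1) * big_part (level p c0 l) x <=
   2 `^ p * (f x `^ p * w x))%R.
Proof.
move=> c00; pose y := (2 * f x / sg x)%R.
have -> : (\sum_(l < N) level p c0 l `^ (p - 1) * big_part (level p c0 l) x)%R =
    (f x * \sum_(l < N | (level p c0 l < y)%R) level p c0 l `^ (p - 1))%R.
  rewrite mulr_sumr [RHS]big_mkcond/=; apply: eq_bigr => l _.
  by rewrite big_partE ltr_pdivlMr//; case: ifP => _; rewrite ?mulr0// mulrC.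
have y0 : (0 <= y)%R by rewrite divr_ge0 ?mulr_ge0// ltW.
apply: (le_trans (ler_wpM2l _ (level_sum p_gt1 c00 N y0))) => //.
have -> : (y `^ (p - 1) = 2 `^ (p - 1) * f x `^ (p - 1) * w x)%R.
  rewrite /y powRM ?mulr_ge0 ?invr_ge0 ?(ltW (sg_gt0 x))// powRM//; congr *%R.
  rewrite -powR_inv1 ?(ltW (sg_gt0 x))// /sg -!powRrM.
  by rewrite mulN1r mulrNN mulVf ?gt_eqF// powRr1// ltW.
have p0 : (0 < p)%R by exact: lt_trans p_gt1.
rewrite -(mulr_powRB1 (f_ge0 x) p0) -(@mulr_powRB1 _ 2 p)//.
by rewrite le_eqVlt; apply/orP; left; apply/eqP; ring.
Qed.

(** Split each p-th power into levels, exchange the sums, bound each level by [carleson_level], and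
    sum the truncations of [f] pointwise. *)
Lemma carleson_embedding :
  (\sum_(i <- S') (F i / S i) `^ p * S i)%:E <=
  (2 / c * D * (2 `^ (p - 1)^-1) `^ p * 2 `^ p)%:E *
    \int[mu]_x (f x `^ p * w x)%:E.
Proof.
have p0 : (0 < p)%R by exact: lt_trans p_gt1.
pose A i : R := (F i / S i)%R.
(* The lowest level lies strictly below every ratio of the finite family and the level [N] above all
   of them, so each ratio is bracketed. *)
have [c0 c00 c0A] := @seq_positive_lower_bound _ _ A S'
  (fun i iS => divr_gt0 (F_gt0 iS) (dual_mass_gt0 i)).
have [N AN] := level_ubound p_gt1 c00 A S'.
pose e := level p c0.
have e0 l : (0 < e l)%R by exact: level_gt0.
pose G : R := (2 / c * D * (2 `^ (p - 1)^-1) `^ p)%R.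
have G0 : (0 <= G)%R.
  by rewrite !mulr_ge0 ?powR_ge0 ?invr_ge0 ?(ltW c_gt0) ?(ltW D_gt0).
pose U l := (\sum_(i <- S' | (e l < A i)%R) S i)%R.
apply: (@le_trans _ _ (\sum_(l < N) e l.+1 `^ p * U l)%:E).
  rewrite lee_fin.
  have -> : (\sum_(l < N) e l.+1 `^ p * U l =
      \sum_(i <- S') (\sum_(l < N | (e l < A i)%R) e l.+1 `^ p) * S i)%R.
    under [RHS]eq_bigr => i _ do rewrite mulr_suml big_mkcond/=.
    rewrite exchange_big/=; apply: eq_bigr => l _.
    rewrite /U mulr_sumr big_mkcond/=; apply: eq_bigr => i _.
    by case: ifP.
  rewrite big_seq [leRHS]big_seq; apply: ler_sum => i iS.
  apply: ler_wpM2r; first exact/ltW/dual_mass_gt0.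
  exact: level_bracket (c0A _ iS) (AN _ iS).
apply: (@le_trans _ _ (\sum_(l < N) (G%:E *
    \int[mu]_x (e l `^ (p - 1) * big_part (e l) x)%:E))).
  rewrite -sumEFin; apply: lee_sum => l _.
  under eq_integral do rewrite EFinM.
  rewrite ge0_integralZl//; last 3 first.
  - exact/measurable_EFinP.
  - by move=> x _; rewrite lee_fin.
  - by rewrite lee_fin powR_ge0.
  have := carleson_level (e0 l).
  (* The factor 2 / c cancels that of [carleson_level]; the p-th power of the ratio of levels and
     e_l^(p-1) turn the remaining e_l into the p-th power of the next level. *)
  move=> /(lee_wpmul2l (x := (2 / c * (2 `^ (p - 1)^-1) `^ p * e l `^ (p - 1))%:E)).
  rewrite lee_fin !mulr_ge0 ?powR_ge0 ?invr_ge0 ?(ltW c_gt0)// => /(_ erefl).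
  rewrite !muleA -!EFinM.
  congr (_%:E <= _%:E * _).
    have -> : (e l.+1 `^ p = (2 `^ (p - 1)^-1) `^ p * (e l * e l `^ (p - 1)))%R.
      rewrite mulr_powRB1 ?(ltW (e0 l))// -powRM ?powR_ge0 ?(ltW (e0 l))//.
      by rewrite /e /level exprS mulrCA.
    by rewrite /U; field; rewrite gt_eqF.
  by rewrite /G; ring.
rewrite -ge0_sume_distrr; last first.
  move=> l _; apply: integral_ge0 => x _.
  by rewrite lee_fin mulr_ge0// powR_ge0.
rewrite -/G [(G * _)%:E]EFinM -muleA.
apply: lee_wpmul2l; first by rewrite lee_fin.
have mfw : measurable_fun setT (fun x => (f x `^ p * w x)%R).
  apply: measurable_funM => //.
  exact: measurableT_comp (measurable_powR _) mf.
rewrite -ge0_integralZl//; last 2 first.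
- exact/measurable_EFinP.
- by move=> x _; rewrite lee_fin mulr_ge0 ?powR_ge0// ltW.
have mterm l : measurable_fun setT (fun x => (e l `^ (p - 1) * big_part (e l) x)%:E).
  by apply/measurable_EFinP; apply: measurable_funM.
rewrite -ge0_integral_sum//; last first.
  by move=> l x _; rewrite lee_fin mulr_ge0// powR_ge0.
apply: ge0_le_integral => //.
- by move=> x _; apply: sume_ge0 => l _; rewrite lee_fin mulr_ge0// powR_ge0.
- exact: emeasurable_sum.
- by apply/measurable_EFinP; apply: measurable_funM.
- by move=> x _; rewrite sumEFin -EFinM lee_fin big_part_levels.
Qed.

End CarlesonEmbedding.

Lemma dual_mass_le_tripled i : (S i <= S (T i))%R.
Proof.
rewrite -lee_fin -!hS; apply: ge0_subset_integral => //.
by move=> x _; rewrite lee_fin ltW.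
Qed.

(** The condition on [F (T i)] says that tripling does not raise the average of [f]. The level set
    is covered by superlevel sets of [w] in triples of selected cubes; [hK] measures these, and the
    Carleson embedding sums the bounds. *)
Lemma weak_type_doubling_averages (c D : R) (s : seq I) (t : R) :
  (0 < c)%R -> (0 < D)%R -> (forall i, (S (T i) <= D * S i)%R) ->
  (forall i E, measurable E -> E `<=` Q i -> (2^-1 * v i)%:E <= mu E ->
    (c * S i)%:E <= \int[mu]_(x in E) (sg x)%:E) ->
  (forall i, i \in s -> (0 < F i)%R /\ (F (T i) <= L * F i)%R) ->
  (0 < t)%R ->
  mu (\big[setU/set0]_(i <- s)
        (Q i `&` [set x | (t < w x * (F i / v i) `^ p)%R])) <=
  (K * (2 * L ^+ 2) `^ p * L `^ p *
     (2 / c * D * (2 `^ (p - 1)^-1) `^ p * 2 `^ p) / t)%:E *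
    \int[mu]_x (f x `^ p * w x)%:E.
Proof.
move=> c0 D0 hD hc Fs t0.
have p0 : (0 < p)%R by exact: lt_trans p_gt1.
have [S' [Ss cS sp]] := exists_sparse_selection c0 hc Fs.
have FS' i : i \in S' -> (0 < F i)%R by move=> /Ss/Fs[].
(* A cube dropped because of [j] has average at most 2 L^2 times that of [j], so on it the level
   condition forces w > b j. *)
pose b j : R := (t / (2 * L ^+ 2 * (F j / v j)) `^ p)%R.
pose V j := Q (T j) `&` [set x | (b j < w x)%R].
have mV j : measurable (V j) by apply: measurableI => //; exact: mwt.
have a0 : (0 < 2 * L ^+ 2)%R by rewrite mulr_gt0// exprn_gt0.
have avg0 j : j \in S' -> (0 < (2 * L ^+ 2 * (F j / v j)) `^ p)%R.
  by move=> /FS' Fj; rewrite powR_gt0// mulr_gt0// divr_gt0.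
have EV : \big[setU/set0]_(i <- s)
    (Q i `&` [set x | (t < w x * (F i / v i) `^ p)%R]) `<=`
    \big[setU/set0]_(j <- S') V j.
  move=> x /(bigsetUP (fun i => _ `&` _))[i /cS[j [jS QiTj Fij]] [_ [Qix tx]]].
  apply/(bigsetUP V); exists j => //; split=> //; split; first exact: QiTj.
  rewrite /= /b ltr_pdivrMr ?avg0//; apply: lt_le_trans tx _.
  rewrite ler_pM2l// ge0_ler_powR ?nnegrE ?(ltW p0)//.
    by rewrite divr_ge0// ltW.
  by rewrite mulr_ge0 ?(ltW a0)// divr_ge0// ltW.
apply: (@le_trans _ _ (\sum_(j <- S') mu (V j))).
  apply: (@le_trans _ _ (mu (\big[setU/set0]_(j <- S') V j))).
    apply: le_measure => //; rewrite inE; apply: bigsetU_measurable => i _ //.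
    by apply: measurableI => //; exact: measurable_gt_scaled_set.
  have := integral_bigsetU_le mu mV (measurable_cst (1 : \bar R))
    (fun=> lee01) S' xpredT.
  rewrite integral_cst ?mul1e; last exact: bigsetU_measurable.
  by under [X in _ <= X -> _]eq_bigr do rewrite integral_cst// mul1e.
pose G := (K * (2 * L ^+ 2) `^ p * L `^ p / t)%R.
have G0 : (0 <= G)%R by rewrite !mulr_ge0 ?powR_ge0 ?invr_ge0 ?ltW.
apply: (@le_trans _ _ (G%:E * (\sum_(j <- S') (F j / S j) `^ p * S j)%:E)).
  rewrite -EFinM mulr_sumr -sumEFin big_seq [leRHS]big_seq.
  apply: lee_sum => j jS; rewrite /V.
  have Fj := FS' _ jS; have Sj := dual_mass_gt0 j.
  have bj0 : (0 < b j)%R by rewrite divr_gt0// avg0.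
  apply: (le_trans (hK _ bj0)); rewrite lee_fin vT /b.
  have Lv : (0 < L * v j)%R by rewrite mulr_gt0.
  (* The exponent 1 - p is negative, so the sigma-mass of the triple may be replaced by the smaller
     mass of the cube. *)
  apply: (@le_trans _ _ (K * (L * v j) / (t / (2 * L ^+ 2 * (F j / v j)) `^ p) *
      (S j / (L * v j)) `^ (1 - p))%R).
    rewrite ler_pM2l; last by rewrite !mulr_gt0// invr_gt0.
    rewrite -opprB !powRN lef_pV2 ?posrE ?powR_gt0 ?divr_gt0 ?dual_mass_gt0//.
    rewrite ge0_ler_powR ?nnegrE ?(ltW p1_gt0) ?divr_ge0 ?(ltW Lv) ?(ltW Sj)//.
      exact/ltW/dual_mass_gt0.
    by rewrite ler_pM2r ?invr_gt0//; exact: dual_mass_le_tripled.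
  (* What remains is the identity v (F/v)^p (S/v)^(1-p) = (F/S)^p S, up to powers of [L]. *)
  rewrite le_eqVlt; apply/orP; left; apply/eqP.
  have E1 : ((S j / (L * v j)) `^ (1 - p) * (S j / (L * v j)) `^ p =
      S j / (L * v j))%R.
    rewrite -powRD ?subrK ?powRr1 ?divr_ge0 ?(ltW Sj) ?(ltW Lv)//.
    by rewrite gt_eqF ?implybT// divr_gt0.
  have E3 x y : (0 < x)%R -> (0 < y)%R -> ((x / y) `^ p = x `^ p / y `^ p)%R.
    move=> x0 y0; rewrite powRM ?invr_ge0 ?(ltW x0) ?(ltW y0)//; congr *%R.
    by rewrite -(powR_inv1 (ltW y0)) powRAC powR_inv1 ?powR_ge0.
  have E2 : ((S j / (L * v j)) `^ p = S j `^ p / (L `^ p * v j `^ p))%R.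
    by rewrite E3// powRM// ltW.
  have pp x : (0 < x)%R -> (0 < x `^ p)%R by exact: powR_gt0.
  have := pp _ Sj; have := pp _ Fj; have := pp _ L_gt0; have := pp _ (v_gt0 j).
  move=> vp Lp Fp Sp.
  have {}E1 : ((S j / (L * v j)) `^ (1 - p) =
      S j / (L * v j) * (L `^ p * v j `^ p) / S j `^ p)%R.
    have Y0 : ((S j / (L * v j)) `^ p != 0)%R.
      by rewrite E2 mulf_neq0// ?invr_neq0 ?mulf_neq0// gt_eqF.
    by apply: (mulIf Y0); rewrite E1 E2; field; rewrite !gt_eqF.
  rewrite E1 /G (powRM p (ltW a0)) ?divr_ge0 ?(ltW Fj) ?(ltW (v_gt0 _))// !E3//.
  field.
  by rewrite !gt_eqF// pp.
have -> : (K * (2 * L ^+ 2) `^ p * L `^ p *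
     (2 / c * D * (2 `^ (p - 1)^-1) `^ p * 2 `^ p) / t =
     G * (2 / c * D * (2 `^ (p - 1)^-1) `^ p * 2 `^ p))%R by rewrite /G mulrAC.
rewrite [(G * (_ * _))%:E]EFinM -muleA; apply: lee_wpmul2l; first by rewrite lee_fin.
exact: carleson_embedding.
Qed.

End CoveringFamily.

Lemma exprn_unbounded (R : realType) (L y : R) : (1 < L)%R ->
  exists k, (y < L ^+ k)%R.
Proof.
move=> L1; have e0 : (0 < L - 1)%R by rewrite subr_gt0.
(* Bernoulli's inequality. *)
have H k : (1 + k%:R * (L - 1) <= L ^+ k)%R.
  elim: k => [|k IH]; first by rewrite mul0r addr0 expr0.
  rewrite exprS; apply: (@le_trans _ _ (L * (1 + k%:R * (L - 1)))%R).
    rewrite -natr1 -subr_ge0.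
    have -> : (L * (1 + k%:R * (L - 1)) - (1 + (k%:R + 1) * (L - 1)) =
        k%:R * ((L - 1) * (L - 1)))%R by ring.
    by rewrite mulr_ge0// mulr_ge0// ltW.
  by rewrite ler_pM2l// (lt_trans ltr01).
exists (Num.bound `|y / (L - 1)|)%R; apply: lt_le_trans (H _).
have yb : (y / (L - 1) < (Num.bound `|y / (L - 1)|)%:R)%R.
  exact: le_lt_trans (ler_norm _) (archi_boundP (normr_ge0 _)).
by move: yb; rewrite ltr_pdivrMr// => yb; lra.
Qed.

(** * Arbitrary finite families: tripling cubes until the average stops increasing *)

Section FiniteFamily.
Context d (X : measurableType d) (R : realType) (mu : {measure set X -> \bar R}).
Context (I : choiceType) (Q : I -> set X) (T : I -> I) (r v : I -> R) (L : R).
Hypotheses (mQ : forall i, measurable (Q i))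
  (muQ : forall i, mu (Q i) = (v i)%:E) (v_gt0 : forall i, (0 < v i)%R)
  (vT : forall i, v (T i) = (L * v i)%R) (L_gt1 : (1 < L)%R)
  (QT : forall i, Q i `<=` Q (T i))
  (meetT : forall i j, Q i `&` Q j !=set0 -> (r j <= r i)%R -> Q j `<=` Q (T i))
  (directed : forall s : seq I, exists b, forall i, i \in s -> Q i `<=` Q b).
Context (w : X -> R) (p : R) (S : I -> R) (K : R).
Hypotheses (mw : measurable_fun setT w) (w_gt0 : forall x, (0 < w x)%R)
  (p_gt1 : (1 < p)%R)
  (hS : forall i, \int[mu]_(x in Q i) (w x `^ (- (p - 1)^-1))%:E = (S i)%:E)
  (K_gt0 : (0 < K)%R)
  (hK : forall i t, (0 < t)%R -> mu (Q i `&` [set x | (t < w x)%R]) <=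
     (K * v i / t * (S i / v i) `^ (1 - p))%:E).

Let L_gt0 : (0 < L)%R. Proof. exact: lt_trans L_gt1. Qed.

Lemma finite_family_weak_type : exists2 C : R, (0 <= C)%R &
  forall (f : X -> R) (F : I -> R) (s : seq I) (t : R),
  measurable_fun setT f -> (forall x, (0 <= f x)%R) ->
  (forall i, \int[mu]_(x in Q i) (f x)%:E = (F i)%:E) -> (0 < t)%R ->
  mu (\big[setU/set0]_(i <- s)
        (Q i `&` [set x | (t < w x * (F i / v i) `^ p)%R])) <=
  (C / t)%:E * \int[mu]_x (f x `^ p * w x)%:E.
Proof.
have p0 : (0 < p)%R by exact: lt_trans p_gt1.
have Li0 : (0 < L^-1)%R by rewrite invr_gt0.
(* A cube fills the fraction 1 / L of its triple, so this instance makes sigma doubling with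
   constant [D^-1]; the instance with fraction 1 / 2 below serves the sparse selection. *)
have [D D0 hD] := dual_weight_ainfty mQ muQ v_gt0 mw w_gt0 p_gt1 hS K_gt0 hK Li0.
have half0 : (0 < 2^-1 :> R)%R by rewrite invr_gt0.
have [c c0 hc] := dual_weight_ainfty mQ muQ v_gt0 mw w_gt0 p_gt1 hS K_gt0 hK half0.
have doubling i : (S (T i) <= D^-1 * S i)%R.
  rewrite mulrC ler_pdivlMr// mulrC -lee_fin -(hS i); apply: hD => //.
  by rewrite muQ vT lee_fin mulrA mulVf ?mul1r ?gt_eqF.
have Di0 : (0 < D^-1)%R by rewrite invr_gt0.
exists (K * (2 * L ^+ 2) `^ p * L `^ p *
     (2 / c * D^-1 * (2 `^ (p - 1)^-1) `^ p * 2 `^ p))%R.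
  by rewrite !mulr_ge0 ?powR_ge0 ?invr_ge0 ?(ltW K_gt0) ?(ltW c0) ?(ltW D0).
move=> f F s t mf f0 hF t0.
have F0 i : (0 <= F i)%R.
  by rewrite -lee_fin -hF integral_ge0// => x _; rewrite lee_fin.
have mEf A : measurable_fun A (EFin \o f).
  by apply/measurable_EFinP; exact: measurable_funTS.
have [B sB] := directed s.
(* Cutting [f] off outside a cube containing the whole family leaves the integrals over its members
   unchanged and bounds all integrals by [F B]. *)
pose f' x : R := (f x * \1_(Q B) x)%R.
have mf' : measurable_fun setT f' by apply: measurable_funM => //; exact: measurable_indic.
have f'0 x : (0 <= f' x)%R by rewrite mulr_ge0// indicE.
have f'f x : (f' x <= f x)%R.
  by rewrite /f' indicE; case: (x \in _); rewrite ?mulr1 ?mulr0.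
have f'E i : \int[mu]_(x in Q i) (f' x)%:E = \int[mu]_(x in Q i `&` Q B) (f x)%:E.
  rewrite integral_mkcondr; apply: eq_integral => x _.
  by rewrite /f' epatch_indic EFinM.
pose F' i := fine (\int[mu]_(x in Q i) (f' x)%:E).
have F'B i : \int[mu]_(x in Q i) (f' x)%:E <= (F B)%:E.
  rewrite f'E -hF; apply: ge0_subset_integral => //; first exact: measurableI.
  by move=> x _; rewrite lee_fin.
have F'ge0 i : 0 <= \int[mu]_(x in Q i) (f' x)%:E.
  by apply: integral_ge0 => x _; rewrite lee_fin.
have hF' i : \int[mu]_(x in Q i) (f' x)%:E = (F' i)%:E.
  rewrite fineK// ge0_fin_numE//; exact: le_lt_trans (F'B i) (ltry _).
have F'F i : i \in s -> F' i = F i.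
  by move=> /sB iB; apply: EFin_inj; rewrite -hF' f'E -hF (setIidl iB).
have F'0 i : (0 <= F' i)%R by rewrite -lee_fin -hF'.
have {}F'B i : (F' i <= F B)%R by rewrite -lee_fin -hF'.
have stop i : (0 < F' i)%R -> exists j, [/\ Q i `<=` Q j,
    (F' i / v i <= F' j / v j)%R, (0 < F' j)%R & (F' (T j) <= L * F' j)%R].
  (* The averages over the iterated triples of [i] cannot increase forever,
     since [f'] is integrable and the volumes tend to infinity. *)
  move=> Fi0; pose P k := (F' (iter k.+1 T i) <= L * F' (iter k T i))%R.
  have exP : exists k, P k.
    apply/not_existsP => nP.
    have grow k : (L ^+ k * F' i <= F' (iter k T i))%R.
      elim: k => [|k IH]; first by rewrite expr0 mul1r.
      have /negP := nP k; rewrite -ltNge => /ltW; apply: le_trans.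
      by rewrite exprS -mulrA ler_pM2l.
    have [k] := exprn_unbounded (F B / F' i) L_gt1.
    rewrite ltr_pdivrMr// ltNge => /negP; apply.
    exact: le_trans (grow k) (F'B _).
  have [k Pk kmin] := ex_minnP exP.
  have grow l : (l <= k)%N -> (L ^+ l * F' i <= F' (iter l T i))%R.
    elim: l => [|l IH lk]; first by rewrite expr0 mul1r.
    have : ~~ P l by apply/negP => /kmin; rewrite leqNgt lk.
    rewrite -ltNge => /ltW; apply: le_trans.
    by rewrite exprS -mulrA ler_pM2l// IH// ltnW.
  have vk l : v (iter l T i) = (L ^+ l * v i)%R.
    by elim: l => [|l IH]; rewrite ?expr0 ?mul1r//= vT IH exprS mulrA.
  exists (iter k T i); split=> //.
  - elim: k {Pk kmin grow} => [|l IH]; first exact: subset_refl.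
    apply: (subset_trans IH); exact: QT.
  - rewrite ler_pdivrMr// vk invfM -!mulrA mulVf ?gt_eqF// mulr1.
    by rewrite ler_pdivlMr ?exprn_gt0// mulrC grow.
  - by apply: lt_le_trans (grow k _) => //; rewrite mulr_gt0// exprn_gt0.
pose nxt i := if pselect (0 < F' i)%R is left h then sval (cid (stop i h)) else i.
pose s' := [seq nxt i | i <- s & (0 < F' i)%R].
have nxtP i : (0 < F' i)%R -> [/\ Q i `<=` Q (nxt i),
    (F' i / v i <= F' (nxt i) / v (nxt i))%R, (0 < F' (nxt i))%R &
    (F' (T (nxt i)) <= L * F' (nxt i))%R].
  by rewrite /nxt => h; case: pselect => // h'; exact: (svalP (cid (stop i h'))).
have s'P j : j \in s' -> (0 < F' j)%R /\ (F' (T j) <= L * F' j)%R.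
  by move=> /mapP[i]; rewrite mem_filter => /andP[/nxtP[_ _ Fj FTj] _] ->.
have := weak_type_doubling_averages mQ muQ v_gt0 vT L_gt1 QT meetT mw w_gt0
  p_gt1 hS K_gt0 hK mf' f'0 hF' c0 Di0 doubling hc s'P t0.
have mlev i (G : R) : measurable (Q i `&` [set x | (t < w x * G)%R]).
  by apply: measurableI => //; exact: measurable_gt_scaled_set.
move=> h; apply: le_trans (le_trans h _).
  apply: le_measure; rewrite ?inE; [exact: bigsetU_measurable|exact: bigsetU_measurable|].
  move=> x /(bigsetUP (fun i => _ `&` _))[i si [_ [Qix tx]]].
  (* A cube with zero integral contributes no point to the level set since t > 0, which is why [s']
     keeps only those with positive integral. *)
  have Fi : (0 < F' i)%R.
    rewrite lt_neqAle F'0 andbT; apply: contraTneq tx => Fi0 /=.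
    by rewrite -(F'F _ si) -Fi0 mul0r powR0 ?gt_eqF// mulr0 -leNgt ltW.
  have [Qn avn Fn _] := nxtP _ Fi.
  apply/(bigsetUP (fun i => _ `&` _)); exists (nxt i).
    by apply/mapP; exists i => //; rewrite mem_filter Fi.
  split=> //; split; first exact: Qn.
  apply: lt_le_trans tx _ => /=; rewrite ler_pM2l// ge0_ler_powR ?nnegrE ?(ltW p0)//.
  - by rewrite divr_ge0// ltW.
  - by rewrite divr_ge0// ltW.
  - by rewrite -(F'F _ si).
apply: lee_wpmul2l.
  by rewrite lee_fin !mulr_ge0 ?powR_ge0 ?invr_ge0 ?(ltW K_gt0) ?(ltW c0) ?(ltW D0) ?(ltW t0).
have mpw (g : X -> R) : measurable_fun setT g ->
    measurable_fun setT (fun x => (g x `^ p * w x)%:E).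
  move=> mg; apply/measurable_EFinP; apply: measurable_funM => //.
  exact: measurableT_comp (measurable_powR _) mg.
apply: ge0_le_integral => //; [|exact: mpw|exact: mpw|].
- by move=> x _; rewrite lee_fin mulr_ge0 ?powR_ge0// ltW.
- move=> x _; rewrite lee_fin ler_pM2r//.
  by rewrite ge0_ler_powR ?nnegrE ?(ltW p0).
Qed.

End FiniteFamily.

(** * Cubes in R^n *)

Section Boxes.
Context (R : realType) (l : R) (l_gt0 : (0 < l)%R).
Local Notation borelR := (measurableTypeR R).

Definition box n (a : 'I_n -> R) (l : R) : set (n.-tuple borelR) :=
  [set x | forall i, (a i <= tnth x i <= a i + l)%R].

Lemma measurable_box n (a : 'I_n -> R) : measurable (box a l).
Proof.
have -> : box a l = \bigcap_(i in [set: 'I_n])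
    ((fun x : n.-tuple borelR => tnth x i) @^-1` `[a i, (a i + l)%R]%classic).
  apply/seteqP; split => [x xa i _|x xa i].
    by rewrite /= in_itv/= xa.
  by have := xa i Logic.I; rewrite /= in_itv.
apply: fin_bigcap_measurable => // i _.
rewrite -[X in measurable X]setTI; exact: measurable_tnth.
Qed.

Lemma borel_lebesgue_box n (a : 'I_n -> R) :
  borel_lebesgue n (box a l) = (l ^+ n)%:E.
Proof.
elim: n a => [|n IH] a.
  have -> : box a l = setT by apply/seteqP; split => // x _ [].
  by rewrite /= diracT expr0.
rewrite /= /borel_lebesgue_step /pushforward.
have -> : @tcons R n @^-1` (box a l) =
    `[a ord0, (a ord0 + l)%R]%classic `*` box (fun i => a (lift ord0 i)) l.
  apply/seteqP; split => -[x y] /=.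
    move=> xy; split; first by have := xy ord0; rewrite /= tnth0 in_itv.
    by move=> i; have := xy (lift ord0 i); rewrite /= tnthS.
  move=> [x0 y0] i; case: (unliftP ord0 i) => [j ->|->].
    by rewrite tnthS; exact: y0.
  by rewrite tnth0; move: x0; rewrite in_itv.
rewrite product_measure1E; [|exact: measurable_itv|exact: measurable_box].
rewrite IH exprS EFinM; congr (_ * _).
have := @lebesgue_measure_itv R `[a ord0, (a ord0 + l)%R].
rewrite /= lte_fin ltrDl l_gt0 -EFinD addrAC subrr add0r => <-.
by [].
Qed.

End Boxes.

Section Cubes.
Context (R : realType) (n : nat).
Local Notation Rn := (Rn R n).
Local Notation mu := (@lebesgue R n).

(* A cube is given by its lowest corner and its side length. *)
Definition cube_index := ({ffun 'I_n -> R} * {l : R | (0 < l)%R})%type.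

Definition side (i : cube_index) : R := sval i.2.

Lemma side_gt0 i : (0 < side i)%R. Proof. exact: (svalP i.2). Qed.

Definition cube_of (i : cube_index) : set Rn :=
  [set x | forall k, (i.1 k <= Rn_coord x k <= i.1 k + side i)%R].

Definition mk_cube (a : 'I_n -> R) (l : R) (l0 : (0 < l)%R) : cube_index :=
  ([ffun k => a k], exist _ l l0).

Lemma cubeP (Q : set Rn) : cube Q <-> exists i, Q = cube_of i.
Proof.
split=> [[a [l [l0 ->]]]|[[a [l l0]] ->]].
  by exists (mk_cube a l0); apply/seteqP; split => x h k; have := h k; rewrite /= ffunE.
by exists a, l.
Qed.

Lemma measurable_cube i : measurable (cube_of i).
Proof. exact: caratheodory_measurable_mu_ext (measurable_box _ _). Qed.

Lemma lebesgue_cube i : mu (cube_of i) = (side i ^+ n)%:E.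
Proof.
rewrite -(borel_lebesgue_box (side_gt0 i) i.1).
rewrite /lebesgue /completed_measure_extension/=.
by rewrite measurable_mu_extE//; exact: measurable_box.
Qed.

Lemma tripled_side_gt0 i : (0 < 3 * side i)%R.
Proof. by rewrite mulr_gt0 ?side_gt0. Qed.

Definition tripled (i : cube_index) : cube_index :=
  mk_cube (fun k => (i.1 k - side i)%R) (tripled_side_gt0 i).

Lemma cube_tripled i j : cube_of i `&` cube_of j !=set0 ->
  (side j <= side i)%R -> cube_of j `<=` cube_of (tripled i).
Proof.
move=> [z [zi zj]] ji x xj k; have := zi k; have := zj k; have := xj k.
rewrite /side/= ffunE -!/(side _) => /andP[? ?] /andP[? ?] /andP[? ?].
by apply/andP; split; lra.
Qed.

Lemma sub_tripled i : cube_of i `<=` cube_of (tripled i).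
Proof. by move=> x xi; apply: (@cube_tripled i i) (xi) => //; exists x. Qed.

Lemma cube_directed (s : seq cube_index) :
  exists b, forall i, i \in s -> cube_of i `<=` cube_of b.
Proof.
pose m := (1 + \sum_(i <- s) (side i + \sum_k `|i.1 k|))%R.
have m0 : (0 < m)%R.
  rewrite ltr_wpDr//; apply: sumr_ge0 => i _.
  by rewrite addr_ge0//; [exact/ltW/side_gt0|exact: sumr_ge0].
have mm0 : (0 < m + m)%R by rewrite addr_gt0.
exists (mk_cube (fun _ => - m)%R mm0) => i si x xi k.
rewrite /side/= ffunE; have /andP[x1 x2] := xi k.
have : (side i + `|i.1 k| <= m)%R.
  rewrite /m (big_rem i)//= (bigD1 k)//=.
  set A := (\sum_(_ | _) _)%R; set B := (\sum_(_ <- _) _)%R.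
  have A0 : (0 <= A)%R by exact: sumr_ge0.
  have B0 : (0 <= B)%R.
    apply: sumr_ge0 => j _.
    by rewrite addr_ge0//; [exact/ltW/side_gt0|exact: sumr_ge0].
  lra.
have := ler_norm (i.1 k); have := ler_norm (- i.1 k)%R; rewrite normrN.
by have := side_gt0 i => *; apply/andP; split; lra.
Qed.

(* Since every cube lies in a rational one of at most three times its side,
   countably many cubes determine the maximal function up to the factor [3^n];
   the default cubes [[0,1]^n] are harmless. *)
Definition rational_cube (k : nat) : cube_index :=
  if @unpickle ({ffun 'I_n -> rat} * rat)%type k is Some (b, m) then
    if pselect (0 < ratr m :> R)%R is left m0
    then mk_cube (fun j => ratr (b j)) m0 else mk_cube (fun=> 0%R) ltr01
  else mk_cube (fun=> 0%R) ltr01.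

Lemma rational_cube_cover i : exists k,
  cube_of i `<=` cube_of (rational_cube k) /\
  (side (rational_cube k) <= 3 * side i)%R.
Proof.
have l0 := side_gt0 i.
(* The corner moves down by less than one side and the new side exceeds two sides, so the original
   cube is still contained. *)
have /choice[b bP] : forall j, exists q : rat,
    ratr q \in `](i.1 j - side i)%R, (i.1 j)[.
  by move=> j; apply: rat_in_itvoo; rewrite ltrBlDr ltrDl.
have [|m] := @rat_in_itvoo R (2 * side i)%R (3 * side i)%R; first lra.
rewrite in_itv/= => /andP[m1 m2].
exists (pickle ([ffun j => b j], m)); rewrite /rational_cube pickleK.
case: pselect => [m0|]; last by move=> []; lra.
split; last by rewrite /side/= ltW.
move=> x xi k; have := xi k; have := bP k; rewrite /side/= !ffunE in_itv/= -/(side _).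
by move=> /andP[? ?] /andP[? ?]; apply/andP; split; lra.
Qed.

(** [lebesgue] is the restriction-free outer measure, so arbitrary sets may be compared, in
    particular level sets of the maximal function. *)
Lemma le_lebesgue (A B : set Rn) : A `<=` B -> mu A <= mu B.
Proof.
by move=> AB; rewrite /lebesgue /completed_measure_extension; exact: le_mu_ext.
Qed.

End Cubes.

Lemma measure_bigcup_le d (X : measurableType d) (R : realType)
    (mu : {measure set X -> \bar R}) (A : nat -> set X) (M : \bar R) :
  (forall k, measurable (A k)) ->
  (forall N, mu (\big[setU/set0]_(k <- iota 0 N) A k) <= M) ->
  mu (\bigcup_k A k) <= M.
Proof.
move=> mA AM; pose B N := \big[setU/set0]_(k <- iota 0 N) A k.
have mB N : measurable (B N) by exact: bigsetU_measurable.
have BA : \bigcup_k A k = \bigcup_N B N.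
  apply/seteqP; split=> [x [k _ Akx]|x [N _ /bigsetUP[k _ [_ Akx]]]]; last by exists k.
  exists k.+1 => //; apply/bigsetUP; exists k => //.
  by rewrite mem_iota /= add0n.
rewrite BA; have Bcvg : (mu \o B) N @[N --> \oo] --> mu (\bigcup_N B N).
  apply: nondecreasing_cvg_mu => //; first exact: bigcupT_measurable.
  move=> N M' NM; apply/subsetPset => x /bigsetUP[k].
  rewrite mem_iota add0n /= => kN [_ Akx]; apply/bigsetUP; exists k => //.
  by rewrite mem_iota add0n /=; exact: leq_trans NM.
rewrite -(cvg_lim _ Bcvg)//; apply: lime_le; first by apply/cvg_ex; exists (mu (\bigcup_N B N)).
by apply: nearW => N; exact: AM.
Qed.

(** * From finite families to all cubes *)

Section PositiveWeight.
Context (R : realType) (n : nat) (hn : (0 < n)%N).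
Local Notation Rn := (Rn R n).
Local Notation mu := (@lebesgue R n).
Local Notation I := (cube_index R n).
Local Notation v := (fun i : I => side i ^+ n)%R.

Lemma volume_gt0 (i : I) : (0 < side i ^+ n)%R.
Proof. by rewrite exprn_gt0// side_gt0. Qed.

Context (w : Rn -> R) (p : R) (S : I -> R) (K : R).
Hypotheses (mw : measurable_fun setT w) (w_gt0 : forall x, (0 < w x)%R)
  (p_gt1 : (1 < p)%R)
  (hS : forall i, \int[mu]_(x in cube_of i) (w x `^ (- (p - 1)^-1))%:E = (S i)%:E)
  (K_gt0 : (0 < K)%R)
  (hK : forall i t, (0 < t)%R -> mu (cube_of i `&` [set x | (t < w x)%R]) <=
     (K * v i / t * (S i / v i) `^ (1 - p))%:E).

Let p_gt0 : (0 < p)%R. Proof. exact: lt_trans p_gt1. Qed.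

(** Replacing a cube by a rational one containing it costs a factor 3^n in the average, hence
    (3^n)^p in the level. The rational cubes are countable, and continuity from below reduces them
    to finite families. *)
Lemma positive_weight_weak_type : exists2 C : R, (0 <= C)%R &
  forall (f : Rn -> R) (F : I -> R) (t : R),
  measurable_fun setT f -> (forall x, (0 <= f x)%R) ->
  (forall i, \int[mu]_(x in cube_of i) (f x)%:E = (F i)%:E) -> (0 < t)%R ->
  mu [set x | exists i, cube_of i x /\ (t < w x * (F i / v i) `^ p)%R] <=
  (C / t)%:E * \int[mu]_x (f x `^ p * w x)%:E.
Proof.
(* Positive dimension enters here: tripling must increase the volume. *)
have L1 : (1 < 3 ^+ n :> R)%R by rewrite exprn_egt1 ?ltr1n// -lt0n.
have L0 : (0 < 3 ^+ n :> R)%R by exact: lt_trans L1.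
have vT i : (v (tripled i) = 3 ^+ n * v i)%R by rewrite /= -exprMn.
have [C C0 hC] := @finite_family_weak_type _ _ _ mu I (@cube_of R n)
  (@tripled R n) (@side R n) v (3 ^+ n)%R (@measurable_cube R n)
  (@lebesgue_cube R n) volume_gt0 vT L1 (@sub_tripled R n)
  (@cube_tripled R n) (@cube_directed R n) w p S K mw w_gt0 p_gt1 hS K_gt0 hK.
exists (C * (3 ^+ n) `^ p)%R; first by rewrite mulr_ge0// powR_ge0.
move=> f F t mf f0 hF t0; pose t' := (t / (3 ^+ n) `^ p)%R.
have t'0 : (0 < t')%R by rewrite divr_gt0// powR_gt0.
have F0 i : (0 <= F i)%R.
  by rewrite -lee_fin -hF integral_ge0// => x _; rewrite lee_fin.
pose V (i : I) := cube_of i `&` [set x | (t' < w x * (F i / v i) `^ p)%R].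
have mV i : measurable (V i).
  apply: measurableI; first exact: measurable_cube.
  exact: measurable_gt_scaled_set.
apply: (@le_trans _ _ (mu (\bigcup_k V (rational_cube R n k)))).
  apply: le_lebesgue => x [i [xi tx]].
  have [k [ik lk]] := rational_cube_cover i.
  exists k => //; split; first exact: ik.
  rewrite /= /t' ltr_pdivrMr ?powR_gt0//; apply: lt_le_trans tx _.
  rewrite -mulrA ler_pM2l// -powRM ?divr_ge0 ?(ltW L0) ?(ltW (volume_gt0 _))//.
  rewrite ge0_ler_powR ?nnegrE ?(ltW p_gt0)//.
  - by rewrite divr_ge0// ltW// volume_gt0.
  - by rewrite mulr_ge0 ?divr_ge0 ?(ltW L0) ?(ltW (volume_gt0 _)).
  set j := rational_cube R n k in ik lk *.
  have vj : (v j <= 3 ^+ n * v i)%R.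
    by rewrite -exprMn lerXn2r ?nnegrE ?mulr_ge0 ?(ltW (side_gt0 _)).
  have Fij : (F i <= F j)%R.
    rewrite -lee_fin -!hF; apply: ge0_subset_integral.
    - exact: measurable_cube.
    - exact: measurable_cube.
    - by apply/measurable_EFinP; exact: measurable_funTS.
    - by move=> y _; rewrite lee_fin.
    - exact: ik.
  rewrite ler_pdivrMr ?volume_gt0//.
  rewrite [leRHS](_ : _ = F j * (3 ^+ n * v i) / v j)%R; last by ring.
  rewrite ler_pdivlMr ?volume_gt0//.
  by rewrite ler_pM// ltW// volume_gt0.
apply: measure_bigcup_le => // N.
have -> : (C * (3 ^+ n) `^ p / t = C / t')%R by rewrite /t' invf_div mulrA.
have := hC f F [seq rational_cube R n k | k <- iota 0 N] t' mf f0 hF t'0.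
by rewrite big_map.
Qed.

End PositiveWeight.

(** Functions of L^p(w) are integrable on cubes of finite sigma-mass, so their integrals over cubes
    can be treated as real numbers. *)
Lemma integral_fin_of_dual_weight d (X : measurableType d) (R : realType)
    (mu : {measure set X -> \bar R}) (D : set X) (w f : X -> R) (p : R) :
  measurable D -> (1 < p)%R ->
  measurable_fun setT w -> (forall x, (0 < w x)%R) ->
  measurable_fun setT f -> (forall x, (0 <= f x)%R) ->
  \int[mu]_(x in D) (w x `^ (- (p - 1)^-1))%:E < +oo ->
  \int[mu]_x (f x `^ p * w x)%:E < +oo ->
  \int[mu]_(x in D) (f x)%:E < +oo.
Proof.
move=> mD p_gt1 mw w_gt0 mf f0 hS fw.
have p_gt0 : (0 < p)%R by exact: lt_trans p_gt1.
have mfw : measurable_fun setT (fun x => (f x `^ p * w x)%:E).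
  apply/measurable_EFinP; apply: measurable_funM => //.
  exact: measurableT_comp (measurable_powR _) mf.
have msg : measurable_fun setT (fun x => (w x `^ (- (p - 1)^-1))%:E).
  by apply/measurable_EFinP; exact: measurableT_comp (measurable_powR _) mw.
have p1 : (0 < p - 1)%R by rewrite subr_gt0.
have fw0 x : 0 <= (f x `^ p * w x)%:E by rewrite lee_fin mulr_ge0 ?powR_ge0// ltW.
have sg0 x : 0 <= (w x `^ (- (p - 1)^-1))%:E by rewrite lee_fin powR_ge0.
(* Pointwise, [f <= sigma] or [f = f^p f^(1-p) <= f^p sigma^(1-p) = f^p w]. *)
apply: (@le_lt_trans _ _ (\int[mu]_(x in D)
    ((f x `^ p * w x)%:E + (w x `^ (- (p - 1)^-1))%:E))).
  apply: ge0_le_integral => //.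
  - by move=> x _; rewrite lee_fin.
  - by apply/measurable_EFinP; exact: measurable_funTS.
  - by apply: emeasurable_funD; exact: measurable_funTS.
  move=> x _; rewrite -EFinD lee_fin.
  have [fsg|sgf] := leP (f x) (w x `^ (- (p - 1)^-1))%R.
    by rewrite ler_wpDl// mulr_ge0 ?powR_ge0// ltW.
  apply: ler_wpDr; first exact: powR_ge0.
  have fx0 : (0 < f x)%R by apply: le_lt_trans sgf; exact: powR_ge0.
  rewrite -(mulr_powRB1 (f0 x) p_gt0) -mulrA ler_peMr// -ler_pdivrMr//.
  rewrite mul1r.
  have -> : ((w x)^-1 = (w x `^ (- (p - 1)^-1)) `^ (p - 1))%R.
    by rewrite -powRrM mulNr mulVf ?gt_eqF// powR_inv1// ltW.
  by rewrite ge0_ler_powR ?nnegrE ?(ltW p1) ?f0 ?powR_ge0// ltW.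
rewrite ge0_integralD//; [|exact: measurable_funTS|exact: measurable_funTS].
rewrite lte_add_pinfty//.
by apply: le_lt_trans fw; exact: ge0_subset_integral.
Qed.

(** * Sufficiency of A_p^* *)

Section NullSets.
Context d (X : measurableType d) (R : realType) (mu : {measure set X -> \bar R}).

Lemma ae_eq_off_null (D N : set X) (f g : X -> \bar R) :
  measurable N -> mu N = 0 -> (forall x, D x -> ~ N x -> f x = g x) ->
  ae_eq mu D f g.
Proof.
move=> mN N0 fg; exists N; split=> // x /= /not_implyP[Dx fgx].
by apply: contra_notP fgx => Nx; exact: fg.
Qed.

Lemma measure_bigcup_null (D : nat -> set X) (A : set X) :
  measurable A -> (forall k, measurable (D k)) ->
  \bigcup_k D k = setT -> (forall k, mu (D k `&` A) = 0) -> mu A = 0.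
Proof.
move=> mA mD DT DA; apply/measure_negligible => //.
have -> : A = \bigcup_k (D k `&` A) by rewrite -setI_bigcupl DT setTI.
apply: negligible_bigcup => k; apply/negligibleP; last exact: DA.
exact: measurableI.
Qed.

Lemma measure_pos_null (g : X -> R) (D : set X) : measurable D ->
  measurable_fun setT g ->
  (forall t, (0 < t)%R -> mu (D `&` [set x | (t < g x)%R]) = 0) ->
  mu (D `&` [set x | (0 < g x)%R]) = 0.
Proof.
move=> mD mg g0; apply/measure_negligible.
  by apply: measurableI => //; exact: measurable_gt_set.
have -> : D `&` [set x | (0 < g x)%R] =
    \bigcup_k (D `&` [set x | (k.+1%:R^-1 < g x)%R]).
  apply/seteqP; split=> [x [Dx gx]|x [k _ [Dx gx]]]; last first.
    by split => //; apply: lt_trans gx; rewrite invr_gt0.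
  have [k kg] : exists k, (k.+1%:R^-1 < g x)%R.
    exists (Num.bound (g x)^-1)%R.
    rewrite -[ltRHS]invrK ltf_pV2 ?posrE ?invr_gt0//.
    apply: lt_trans (archi_boundP _) _; first by rewrite invr_ge0 ltW.
    by rewrite ltr_nat.
  by exists k.
apply: negligible_bigcup => k; apply/negligibleP.
  by apply: measurableI => //; exact: measurable_gt_set.
by apply: g0; rewrite invr_gt0.
Qed.

End NullSets.

(** * The dual weight, and passage to a positive weight *)

Section DualWeight.
Context d (X : measurableType d) (R : realType) (mu : {measure set X -> \bar R}).
Context (w : X -> R) (a : R).
Hypothesis mw : measurable_fun setT w.

Definition dual (x : X) : \bar R := if w x == 0%R then +oo else (w x `^ a)%:E.

Lemma measurable_dual : measurable_fun setT dual.
Proof.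
apply: measurable_fun_ifT.
- apply: measurable_fun_eqr => //; exact: measurable_cst.
- exact: measurable_cst.
- by apply/measurable_EFinP; exact: measurableT_comp (measurable_powR _) mw.
Qed.

Lemma dual_gt0 x : 0 < dual x.
Proof.
rewrite /dual; case: ifPn => // w0; rewrite lte_fin lt_neqAle powR_ge0 andbT.
by rewrite eq_sym powR_eq0 negb_and w0.
Qed.

Lemma measurable_le0_set : measurable [set x | (w x <= 0)%R].
Proof.
have -> : [set x | (w x <= 0)%R] = ~` [set x | (0 < w x)%R].
  by apply/seteqP; split => x /=; rewrite leNgt => /negP.
exact/measurableC/measurable_gt_set.
Qed.

Lemma measurable_eq0_set : measurable [set x | w x = 0%R].
Proof.
have -> : [set x | w x = 0%R] = w @^-1` [set 0%R] by [].
by rewrite -[X in measurable X]setTI; exact: mw.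
Qed.

Lemma dual_fin_null (D : set X) : measurable D ->
  \int[mu]_(x in D) dual x < +oo -> mu (D `&` [set x | w x = 0%R]) = 0.
Proof.
move=> mD; apply: contraPP => /eqP D0; apply/negP; rewrite -leNgt leye_eq.
have mDZ : measurable (D `&` [set x | w x = 0%R]).
  by apply: measurableI => //; exact: measurable_eq0_set.
have ioo : \int[mu]_(x in D `&` [set x | w x = 0%R]) dual x = +oo.
  transitivity (\int[mu]_(x in D `&` [set x | w x = 0%R]) (cst +oo x : \bar R)).
    by apply: eq_integral => x /[!inE] -[_ /= wx]; rewrite /dual wx eqxx.
  by rewrite integral_cst// gt0_mulye// lt0e D0 measure_ge0.
rewrite -leye_eq -ioo; apply: ge0_subset_integral => //.
- by apply: measurable_funTS; exact: measurable_dual.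
- by move=> x _; exact/ltW/dual_gt0.
Qed.

(* Only used when [w > 0] almost everywhere. *)
Definition pos_weight (x : X) : R := if (0 < w x)%R then w x else 1%R.

Lemma measurable_pos_weight : measurable_fun setT pos_weight.
Proof.
apply: measurable_fun_ifT => //.
by apply: measurable_fun_ltr => //; exact: measurable_cst.
Qed.

Lemma pos_weight_gt0 x : (0 < pos_weight x)%R.
Proof. by rewrite /pos_weight; case: ifPn. Qed.

Lemma pos_weightE x : ~ (w x <= 0)%R -> pos_weight x = w x.
Proof. by move=> /negP; rewrite -ltNge /pos_weight => ->. Qed.

Hypothesis w_le0_null : mu [set x | (w x <= 0)%R] = 0.

Lemma integral_pos_weight_dual (D : set X) : measurable D ->
  \int[mu]_(x in D) (pos_weight x `^ a)%:E = \int[mu]_(x in D) dual x.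
Proof.
move=> mD; apply: ge0_ae_eq_integral => //.
- apply: measurable_funTS; apply/measurable_EFinP.
  exact: measurableT_comp (measurable_powR _) measurable_pos_weight.
- by apply: measurable_funTS; exact: measurable_dual.
- by move=> x _; rewrite lee_fin powR_ge0.
- by move=> x _; exact/ltW/dual_gt0.
apply: (ae_eq_off_null measurable_le0_set w_le0_null) => x _ wx.
rewrite /dual pos_weightE//; case: eqP => // wx0.
by case: wx; rewrite /= wx0.
Qed.

Lemma integral_pos_weight (f : X -> R) (p : R) : measurable_fun setT f ->
  \int[mu]_x (f x `^ p * pos_weight x)%:E = \int[mu]_x (f x `^ p * w x)%:E.
Proof.
move=> mf; have mfp : measurable_fun setT (fun x => (f x `^ p)%R).
  exact: measurableT_comp (measurable_powR _) mf.
apply: ae_eq_integral => //.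
- apply/measurable_EFinP; apply: measurable_funM => //.
  exact: measurable_pos_weight.
- by apply/measurable_EFinP; exact: measurable_funM.
apply: (ae_eq_off_null measurable_le0_set w_le0_null) => x _ wx.
by rewrite pos_weightE.
Qed.

End DualWeight.

Section Sufficiency.
Context (R : realType) (n : nat) (hn : (0 < n)%N).
Local Notation Rn := (Rn R n).
Local Notation mu := (@lebesgue R n).
Local Notation I := (cube_index R n).
Local Notation v := (fun i : I => side i ^+ n)%R.

Lemma cube_exhaustion (i : I) : exists D : nat -> I,
  (forall k, cube_of i `<=` cube_of (D k)) /\ \bigcup_k cube_of (D k) = setT.
Proof.
have l0 k : (0 < side i + 2 * k%:R)%R.
  by rewrite ltr_pwDl ?side_gt0// mulr_ge0.
exists (fun k => mk_cube (fun j => i.1 j - k%:R)%R (l0 k)); split.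
  move=> k x xi j; have := xi j; rewrite /side/= ffunE -/(side i) => /andP[? ?].
  have k0 : (0 <= k%:R :> R)%R by [].
  by apply/andP; split; lra.
apply/seteqP; split=> // x _.
pose M := (\sum_j `|Rn_coord x j - i.1 j|)%R.
have M0 : (0 <= M)%R by exact: sumr_ge0.
exists (Num.bound M) => // j; rewrite /side/= ffunE -/(side i).
have := archi_boundP M0; set N := (_%:R)%R => MN.
have : (`|Rn_coord x j - i.1 j| <= M)%R.
  by rewrite /M (bigD1 j)//= lerDl sumr_ge0.
have s0 := side_gt0 i.
by rewrite ler_norml => /andP[? ?]; apply/andP; split; lra.
Qed.

Lemma lebesgue_cube_gt0 (i : I) : 0 < mu (cube_of i).
Proof. by rewrite lebesgue_cube lte_fin volume_gt0. Qed.

Lemma cube_averageE (i : I) (g : Rn -> \bar R) :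
  cube_average (cube_of i) g = (v i)^-1%:E * \int[mu]_(x in cube_of i) g x.
Proof.
by rewrite /cube_average lebesgue_cube inver gt_eqF// volume_gt0.
Qed.

Lemma weakLp_norm_ge0 (q : R) (g : Rn -> \bar R) : 0 <= weakLp_norm q g.
Proof.
apply: le_trans (ereal_sup_ubound _); last by exists 1%R => //; rewrite /= ltr01.
by rewrite mul1e poweR_ge0.
Qed.

Lemma weakL1_ge (g : Rn -> R) (t : R) : (0 < t)%R ->
  t%:E * mu [set x | (t < `|g x|)%R] <= weakLp_norm 1 (fun x => (g x)%:E).
Proof.
move=> t0; apply: ereal_sup_ubound; exists t => //.
by rewrite invr1 poweRe1.
Qed.

Context (p : R) (p_gt1 : (1 < p)%R) (w : Rn -> R).
Local Notation weakQ i := (weakLp_norm 1 (fun x => (w x * \1_(cube_of i) x)%:E)).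

Let p1_gt0 : (0 < p - 1)%R. Proof. by rewrite subr_gt0. Qed.
Let p_gt0 : (0 < p)%R. Proof. exact: lt_trans p_gt1. Qed.

Lemma conj_expE : (1 - conj_exp p = - (p - 1)^-1)%R.
Proof. by rewrite /conj_exp; field; rewrite gt_eqF. Qed.

Lemma dual_weightE : dual_weight p w = dual w (- (p - 1)^-1).
Proof. by apply/funext => x; rewrite /dual_weight /dual conj_expE. Qed.

Lemma Apstar_bound : Apstar p w -> exists2 K : R, (0 < K)%R &
  forall i, (v i)^-1%:E * weakQ i *
    ((v i)^-1%:E * \int[mu]_(x in cube_of i) dual w (- (p - 1)^-1) x) `^ (p - 1)
    <= K%:E.
Proof.
rewrite /Apstar => Ap.
exists (1 + `|fine (Apstar_const p w)|)%R; first by rewrite ltr_pwDl.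
move=> i; rewrite -dual_weightE -cube_averageE.
have -> : (v i)^-1%:E = (mu (cube_of i))^-1.
  by rewrite lebesgue_cube inver gt_eqF// volume_gt0.
apply: (@le_trans _ _ (Apstar_const p w)).
  apply: ereal_sup_ubound; exists (cube_of i) => //.
  by apply/cubeP; exists i.
case: (Apstar_const p w) Ap => [r _| |] //; last by move=> _; exact: leNye.
by rewrite lee_fin; have := ler_norm r; rewrite /=; lra.
Qed.


Lemma weight_null_of_weak_norm_eq0 i : measurable_fun setT w -> weakQ i = 0 ->
  mu (cube_of i `&` [set x | (0 < w x)%R]) = 0.
Proof.
move=> mw wi; apply: measure_pos_null; [exact: measurable_cube|exact: mw|].
move=> t t0; apply/eqP; rewrite -measure_le0.
apply: (@le_trans _ _ (mu [set x | (t < `|w x * \1_(cube_of i) x|)%R])).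
  apply: le_lebesgue => x [xi tx] /=.
  rewrite indicE mem_set// mulr1; exact: lt_le_trans (ler_norm _).
have := weakL1_ge (fun x => w x * \1_(cube_of i) x)%R t0.
by rewrite wi pmule_rle0 ?lte_fin.
Qed.

Lemma weakLp_norm_le (g : Rn -> \bar R) (C M : R) : (0 <= C)%R -> (0 <= M)%R ->
  (forall l, (0 < l)%R ->
     mu [set x | l%:E < `|g x|] <= (C / l `^ p * M)%:E) ->
  weakLp_norm p g <= (C `^ p^-1)%:E * M%:E `^ p^-1.
Proof.
move=> C0 M0 gl; apply: ge_ereal_sup => _ [l /= l0 <-].
have pV0 : (0 <= p^-1)%R by rewrite invr_ge0 ltW.
have lp0 : (0 < l `^ p)%R by exact: powR_gt0.
have ml0 : 0 <= mu [set x | l%:E < `|g x|] by exact: measure_ge0.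
apply: (@le_trans _ _ (l%:E * ((C / l `^ p * M)%:E) `^ p^-1)).
  apply: lee_wpmul2l; first by rewrite lee_fin ltW.
  apply: gt0_ler_poweR => //; first by rewrite in_itv/= ml0 leey.
    by rewrite in_itv/= lee_fin leey andbT !mulr_ge0// invr_ge0 ltW.
  exact: gl.
rewrite !poweR_EFin -!EFinM lee_fin.
rewrite powRM ?mulr_ge0 ?invr_ge0 ?(ltW lp0)// powRM ?invr_ge0 ?(ltW lp0)//.
have -> : ((l `^ p)^-1 `^ p^-1 = l^-1)%R.
  by rewrite -powRN -powRrM mulNr mulfV ?gt_eqF// powR_inv1// ltW.
by rewrite le_eqVlt; apply/orP; left; apply/eqP; field; rewrite gt_eqF.
Qed.

Lemma cube_maximal_ge0 (f : Rn -> R) x : 0 <= cube_maximal f x.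
Proof.
pose i : I := mk_cube (fun=> 0%R) (@ltr01 R).
apply: (@le_trans _ _ (cube_average (cube_of i) (fun y => `|f y|%:E) *
    (\1_(cube_of i) x)%:E)).
  apply: mule_ge0; last by rewrite lee_fin indicE.
  rewrite cube_averageE mule_ge0 ?lee_fin ?invr_ge0 ?(ltW (volume_gt0 _))//.
  by apply: integral_ge0 => y _; rewrite lee_fin.
by apply: ereal_sup_ubound; exists (cube_of i) => //; apply/cubeP; exists i.
Qed.

(** A supremum above a number is already exceeded by one cube, which must contain [x] since its term
    is otherwise zero; then take p-th powers. *)
Lemma powR_weight_level (f : Rn -> R) (F : I -> R) (x : Rn) (l : R) :
  (forall i, \int[mu]_(y in cube_of i) `|f y|%:E = (F i)%:E) ->
  (0 < l)%R -> (0 < w x)%R ->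
  l%:E < `|(w x `^ p^-1)%:E * cube_maximal f x| ->
  exists i, cube_of i x /\ (l `^ p < w x * (F i / v i) `^ p)%R.
Proof.
move=> hF l0 wx0; have wp0 : (0 < w x `^ p^-1)%R by exact: powR_gt0.
rewrite gee0_abs; last first.
  by rewrite mule_ge0 ?cube_maximal_ge0// lee_fin ltW.
rewrite -lte_pdivrMl// => /ereal_sup_gt[_ [_ /cubeP[i ->] <-]].
rewrite cube_averageE hF -!EFinM lte_fin indicE.
have [xi|xi] := boolP (x \in cube_of i); last first.
  by rewrite mulr0 ltNge mulr_ge0// ?invr_ge0 ltW.
rewrite mulr1 ltr_pdivrMl// => lF; exists i; split; first by rewrite inE in xi.
have F0 : (0 <= F i / v i)%R.
  rewrite divr_ge0 ?(ltW (volume_gt0 _))// -lee_fin -hF.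
  by apply: integral_ge0 => y _; rewrite lee_fin.
have -> : (w x * (F i / v i) `^ p = (w x `^ p^-1 * (F i / v i)) `^ p)%R.
  rewrite (powRM _ (ltW wp0) F0) -powRrM mulVf ?gt_eqF// powRr1//.
  exact: ltW.
rewrite gt0_ltr_powR ?nnegrE ?(ltW l0) ?(mulr_ge0 (ltW wp0) F0)//.
by rewrite [(F i / _)%R]mulrC.
Qed.


Lemma weight_lt0_null : weight w -> mu [set x | (w x < 0)%R] = 0.
Proof.
move=> [mw [N [mN N0 wN]]]; apply/eqP; rewrite -measure_le0 -N0.
apply: le_lebesgue => x /= wx; apply: wN => /=.
by apply/negP; rewrite -ltNge.
Qed.

(** Where [w] vanishes the product is zero even if the maximal function is infinite, by 0 * +oo = 0;
    elsewhere is a null set. *)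
Lemma weakLp_norm_maximal_null : weight w -> mu [set x | (0 < w x)%R] = 0 ->
  forall f : Rn -> R,
  weakLp_norm p (fun x => (w x `^ p^-1)%:E * cube_maximal f x) = 0.
Proof.
move=> ww w0 f; apply/eqP; rewrite eq_le weakLp_norm_ge0 andbT.
apply: ge_ereal_sup => _ [l /= l0 <-].
have pV0 : (p^-1 != 0)%R by rewrite invr_neq0// gt_eqF.
suff -> : mu [set x | l%:E < `|(w x `^ p^-1)%:E * cube_maximal f x|] = 0 by rewrite poweR0r// mule0.
have mw : measurable_fun setT w by case: ww.
apply/eqP; rewrite -measure_le0.
have <- : mu [set x | (w x < 0)%R] + mu [set x | (0 < w x)%R] = 0.
  by rewrite weight_lt0_null// w0 adde0.
have mneg : measurable [set x | (w x < 0)%R] by exact: measurable_lt_set.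
have mpos : measurable [set x | (0 < w x)%R] by exact: measurable_gt_set.
apply: le_trans (measureU2 _ mneg mpos); apply: le_lebesgue => x /= lg.
have [wx|wx|wx] := ltgtP (w x) 0%R; [by left|by right|].
by move: lg; rewrite wx powR0// mul0e abse0 lte_fin ltNge ltW.
Qed.


Local Notation sigma := (dual w (- (p - 1)^-1)).

(* With [0 * +oo = 0], a cube of infinite sigma-mass forces the weak norm of [w]
   on every larger cube to vanish. *)
Lemma weight_null_of_infinite_dual (K : R) (i : I) : measurable_fun setT w ->
  (forall i, (v i)^-1%:E * weakQ i *
    ((v i)^-1%:E * \int[mu]_(x in cube_of i) sigma x) `^ (p - 1) <= K%:E) ->
  \int[mu]_(x in cube_of i) sigma x = +oo ->
  mu [set x | (0 < w x)%R] = 0.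
Proof.
move=> mw Kw ioo; have [D [iD DT]] := cube_exhaustion i.
have mD k : measurable (cube_of (D k)) by exact: measurable_cube.
apply: (measure_bigcup_null _ mD DT); first exact: measurable_gt_set.
move=> k; apply: weight_null_of_weak_norm_eq0 => //.
have Doo : \int[mu]_(x in cube_of (D k)) sigma x = +oo.
  apply/eqP; rewrite -leye_eq -ioo; apply: ge0_subset_integral.
  - exact: measurable_cube.
  - exact: mD.
  - by apply: measurable_funTS; exact: measurable_dual.
  - by move=> x _; exact/ltW/dual_gt0.
  - exact: iD.
have vD0 : (0 < (v (D k))^-1)%R by rewrite invr_gt0 volume_gt0.
have := Kw (D k); rewrite Doo gt0_muley ?lte_fin// poweRyr ?gt_eqF//.
have weak0 : 0 <= weakQ (D k) by exact: weakLp_norm_ge0.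
apply: contraTeq => weakN0; rewrite gt0_muley ?leye_eq//.
by rewrite mule_gt0 ?lte_fin// lt0e weakN0.
Qed.

Lemma Apstar_sufficient : weight w -> Apstar p w ->
  exists C : R, forall f : Rn -> R, Lp_weight p w f ->
     weakLp_norm p (fun x => (w x `^ p^-1)%:E * cube_maximal f x)
       <= C%:E * Lp_weight_norm p w f.
Proof.
move=> ww /Apstar_bound[K K0 Kw]; have mw : measurable_fun setT w by case: ww.
(* If one cube has infinite sigma-mass, [w] is zero almost everywhere and the constant 0 works. *)
have [[i ioo]|fin] := pselect (exists i, \int[mu]_(x in cube_of i) sigma x = +oo).
  have w0 := weight_null_of_infinite_dual mw Kw ioo.
  exists 0%R => f _; rewrite (weakLp_norm_maximal_null ww w0).
  by rewrite mul0e.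
have {}fin i : \int[mu]_(x in cube_of i) sigma x < +oo.
  by rewrite ltey; apply/eqP => ioo; apply: fin; exists i.
have mZ : measurable [set x | w x = 0%R] by exact: measurable_eq0_set.
have mneg : measurable [set x | (w x < 0)%R] by exact: measurable_lt_set.
(* Otherwise sigma is finite almost everywhere, so [w] is positive almost everywhere and may be
   replaced by [pos_weight w]. *)
have Z0 : mu [set x | w x = 0%R] = 0.
  have [D [_ DT]] := cube_exhaustion (mk_cube (fun=> 0%R) (@ltr01 R)).
  have mD k : measurable (cube_of (D k)) by exact: measurable_cube.
  apply: (measure_bigcup_null mZ mD DT) => k.
  by apply: dual_fin_null mw _ _ (fin _); exact: measurable_cube.
have mN : measurable [set x | (w x <= 0)%R] by exact: measurable_le0_set.
have N0 : mu [set x | (w x <= 0)%R] = 0.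
  apply/eqP; rewrite -measure_le0.
  have <- : mu [set x | w x = 0%R] + mu [set x | (w x < 0)%R] = 0.
    by rewrite weight_lt0_null// Z0 adde0.
  apply: le_trans (measureU2 _ mZ mneg); apply: le_lebesgue => x /=.
  by rewrite le_eqVlt => /orP[/eqP|]; [left|right].
pose w' := pos_weight w; pose S i := fine (\int[mu]_(x in cube_of i) sigma x).
have mw' : measurable_fun setT w' by exact: measurable_pos_weight.
have w'0 x : (0 < w' x)%R by exact: pos_weight_gt0.
have S_int i : \int[mu]_(x in cube_of i) sigma x = (S i)%:E.
  rewrite fineK// ge0_fin_numE//; apply: integral_ge0 => x _.
  exact/ltW/dual_gt0.
have hS i : \int[mu]_(x in cube_of i) (w' x `^ (- (p - 1)^-1))%:E = (S i)%:E.
  by rewrite -S_int integral_pos_weight_dual//; exact: measurable_cube.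
have S0 i : (0 < S i)%R.
  rewrite -lte_fin -S_int; apply: integral_gt0.
  - exact: measurable_cube.
  - by apply: measurable_funTS; exact: measurable_dual.
  - exact: lebesgue_cube_gt0.
  - by move=> x _; exact: dual_gt0.
(* The weak norm bounds each superlevel set, and dividing the A_p^* bound by the positive power of
   the sigma-average gives the exponent 1 - p. *)
have hK i t : (0 < t)%R -> mu (cube_of i `&` [set x | (t < w' x)%R]) <=
     (K * v i / t * (S i / v i) `^ (1 - p))%:E.
  move=> t0; set W := [set x | (t < `|w x * \1_(cube_of i) x|)%R].
  have le_mW : mu (cube_of i `&` [set x | (t < w' x)%R]) <= mu W.
    have -> : mu W = mu [set x | (w x <= 0)%R] + mu W by rewrite N0 add0e.
    apply: le_trans (measureU2 _ mN _).
      apply: le_lebesgue => x [xi /= tx].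
      have [|wx] := leP (w x) 0%R; first by left.
      right; rewrite /W /= indicE mem_set// mulr1.
      apply: lt_le_trans (ler_norm _); apply: lt_le_trans tx _.
      by rewrite /w' pos_weightE//; apply/negP; rewrite -ltNge.
    by apply: measurable_gt_norm_indic_set => //; exact: measurable_cube.
  apply: (le_trans le_mW).
  have := Kw i; rewrite S_int -EFinM poweR_EFin.
  set s := (_ `^ (p - 1))%R; have s0 : (0 < s)%R.
    by rewrite powR_gt0// mulr_gt0 ?invr_gt0 ?volume_gt0.
  have vi0 : (0 < v i)%R by exact: volume_gt0.
  have weakK := weakL1_ge (fun x => w x * \1_(cube_of i) x)%R t0.
  move=> Ki; rewrite -(@lee_pmul2l _ t%:E)//.
  apply: (le_trans weakK).
  have -> : t%:E * (K * v i / t * (S i / v i) `^ (1 - p))%:E =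
      ((v i) / s)%:E * K%:E.
    rewrite -!EFinM; congr EFin; rewrite -opprB powRN /s [(S i / _)%R]mulrC.
    by field; rewrite !gt_eqF// powR_gt0// mulr_gt0 ?invr_gt0.
  apply: le_trans (lee_wpmul2l _ Ki); last by rewrite lee_fin divr_ge0// ltW.
  rewrite [X in _ * X]muleAC muleA -!EFinM.
  rewrite (_ : (v i / s * ((v i)^-1 * s) = 1)%R) ?mul1e//.
  by field; rewrite !gt_eqF.
have [C C0 hC] := positive_weight_weak_type hn mw' w'0 p_gt1 hS K0 hK.
exists (C `^ p^-1)%R => f [mf fLp].
have mabs : measurable_fun setT (fun x => `|f x|%R) by exact: measurableT_comp mf.
have normE : Lp_weight_norm p w f =
    (\int[mu]_x (`|f x| `^ p * w' x)%:E) `^ p^-1.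
  by rewrite /Lp_weight_norm (integral_pos_weight mw N0 p mabs).
have pV0 : (p^-1 != 0)%R by rewrite invr_neq0// gt_eqF.
move: fLp; rewrite normE => /(lty_poweRy pV0) fLp.
have f_ge0 x : (0 <= `|f x|)%R by [].
have Fint i : \int[mu]_(x in cube_of i) `|f x|%:E =
    (fine (\int[mu]_(x in cube_of i) `|f x|%:E))%:E.
  rewrite fineK// ge0_fin_numE; last by apply: integral_ge0 => x _; rewrite lee_fin.
  apply: (integral_fin_of_dual_weight _ p_gt1 mw' w'0 mabs f_ge0 _ fLp).
    exact: measurable_cube.
  by rewrite hS ltry.
set M := \int[mu]_x (`|f x| `^ p * w' x)%:E in fLp *.
have M0 : 0 <= M.
  by apply: integral_ge0 => x _; rewrite lee_fin mulr_ge0 ?powR_ge0// ltW.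
have Mfin : M = (fine M)%:E by rewrite fineK// ge0_fin_numE.
rewrite Mfin; apply: weakLp_norm_le => //; first exact: fine_ge0.
move=> l l0; have lp0 : (0 < l `^ p)%R by exact: powR_gt0.
have := hC (fun x => `|f x|%R) _ _ mabs f_ge0 Fint lp0.
rewrite -/M Mfin -EFinM; apply: le_trans.
(* [Y] involves uncountably many cubes, so the null set where [w] is nonpositive is split off by
   subadditivity of the outer measure. *)
set Y := [set x | exists i, _].
have -> : mu Y = mu [set x | (w x <= 0)%R] + mu Y by rewrite N0 add0e.
apply: le_trans (outer_measureU2 _ _ _).
apply: le_lebesgue => x /= lx.
have [|wx] := leP (w x) 0%R; [by left|right].
have [i [xi lw]] := powR_weight_level Fint l0 wx lx.
exists i; split=> //; rewrite /w' pos_weightE//.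
by apply/negP; rewrite -ltNge.
Qed.

End Sufficiency.

(** * Necessity of A_p^* *)

Section RegularizedDualWeight.
Context d (X : measurableType d) (R : realType) (mu : {measure set X -> \bar R}).
Context (w : X -> R) (p : R) (p_gt1 : (1 < p)%R).
Hypotheses (mw : measurable_fun setT w) (w_lt0_null : mu [set x | (w x < 0)%R] = 0).
Local Notation a := (- (p - 1)^-1)%R.

Let p1_gt0 : (0 < p - 1)%R. Proof. by rewrite subr_gt0. Qed.
Let p_gt0 : (0 < p)%R. Proof. exact: lt_trans p_gt1. Qed.

Definition shifted_weight (k : nat) (x : X) : R := (Num.max (w x) 0 + k.+1%:R^-1)%R.

Definition regularized_dual (k : nat) (x : X) : R := (shifted_weight k x `^ a)%R.

Lemma shifted_weight_gt0 k x : (0 < shifted_weight k x)%R.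
Proof. by rewrite ltr_wpDl ?invr_gt0// le_max lexx orbT. Qed.

Lemma regularized_dual_gt0 k x : (0 < regularized_dual k x)%R.
Proof. by rewrite powR_gt0// shifted_weight_gt0. Qed.

Lemma measurable_regularized_dual k : measurable_fun setT (regularized_dual k).
Proof.
apply: (measurableT_comp (measurable_powR _)).
apply: measurable_funD; last exact: measurable_cst.
by apply: measurable_maxr => //; exact: measurable_cst.
Qed.

Lemma le_dual_exponent x y : (0 < x)%R -> (x <= y)%R -> (y `^ a <= x `^ a)%R.
Proof.
move=> x0 xy; have y0 : (0 < y)%R by exact: lt_le_trans xy.
rewrite !powRN lef_pV2 ?posrE ?powR_gt0//.
by rewrite ge0_ler_powR ?nnegrE ?invr_ge0 ?(ltW p1_gt0) ?(ltW x0) ?(ltW y0).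
Qed.

Lemma regularized_dual_le k x : (regularized_dual k x <= k.+1%:R^-1 `^ a)%R.
Proof.
apply: le_dual_exponent; first by rewrite invr_gt0.
by rewrite lerDr le_max lexx orbT.
Qed.

Lemma regularized_dual_nondecreasing k l x : (k <= l)%N ->
  (regularized_dual k x <= regularized_dual l x)%R.
Proof.
move=> kl; apply: le_dual_exponent; first exact: shifted_weight_gt0.
by rewrite lerD2l lef_pV2 ?posrE// ler_nat.
Qed.

(** The shifted weight is its own dual raised to 1 - p, and p + (1 - p) = 1. *)
Lemma shifted_weight_powR k x :
  (regularized_dual k x `^ p * shifted_weight k x = regularized_dual k x)%R.
Proof.
have sh0 := shifted_weight_gt0 k x.
have -> : shifted_weight k x = (regularized_dual k x `^ (1 - p))%R.
  have -> : (1 - p = - (p - 1))%R by rewrite opprB.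
  by rewrite /regularized_dual -powRrM mulrNN mulVf ?gt_eqF// powRr1// ltW.
rewrite -powRD; last by rewrite (gt_eqF (regularized_dual_gt0 k x)) implybT.
by rewrite addrCA subrr addr0 powRr1// ltW// regularized_dual_gt0.
Qed.

Lemma integral_max_weight (f : X -> R) : measurable_fun setT f ->
  \int[mu]_x (f x * w x)%:E = \int[mu]_x (f x * Num.max (w x) 0)%:E.
Proof.
move=> mf; apply: ae_eq_integral => //.
- by apply/measurable_EFinP; exact: measurable_funM.
- apply/measurable_EFinP; apply: measurable_funM => //.
  by apply: measurable_maxr => //; exact: measurable_cst.
apply: (ae_eq_off_null (measurable_lt_set 0 mw) w_lt0_null) => x _ /negP.
by rewrite -leNgt => wx; rewrite (max_idPl wx).
Qed.

(** Almost everywhere [w] equals max(w, 0), which is at most the shifted weight;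
    [shifted_weight_powR] then gives the upper bound. The lower bound also passes through max(w, 0),
    as [w] may be negative on a null set. *)
Lemma integral_test_function k (Q : set X) : measurable Q ->
  0 <= \int[mu]_x (`|regularized_dual k x * \1_Q x| `^ p * w x)%:E <=
  \int[mu]_(x in Q) (regularized_dual k x)%:E.
Proof.
move=> mQ; pose f x := `|regularized_dual k x * \1_Q x|%R.
have mf : measurable_fun setT f.
  apply: measurableT_comp => //; apply: measurable_funM.
    exact: measurable_regularized_dual.
  exact: measurable_indic.
have mfp : measurable_fun setT (fun x => (f x `^ p)%R).
  exact: measurableT_comp (measurable_powR _) mf.
have mwp : measurable_fun setT (fun x => Num.max (w x) 0%R).
  by apply: measurable_maxr => //; exact: measurable_cst.
rewrite integral_max_weight//; apply/andP; split.
  apply: integral_ge0 => x _.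
  by rewrite lee_fin mulr_ge0 ?powR_ge0// le_max lexx orbT.
rewrite [leRHS]integral_mkcond; apply: ge0_le_integral => //.
- by move=> x _; rewrite lee_fin mulr_ge0 ?powR_ge0// le_max lexx orbT.
- by apply/measurable_EFinP; exact: measurable_funM.
- apply/(measurable_restrictT _ mQ)/measurable_funTS/measurable_EFinP.
  exact: measurable_regularized_dual.
move=> x _; rewrite /patch /f indicE; case: ifPn => xQ; last first.
  by rewrite mulr0 normr0 powR0 ?gt_eqF// mul0r.
rewrite mulr1 gtr0_norm ?regularized_dual_gt0// lee_fin.
rewrite -[leRHS]shifted_weight_powR.
rewrite ler_pM2l; last exact: powR_gt0 (regularized_dual_gt0 k x).
by rewrite lerDl invr_ge0.
Qed.

Lemma dual_le_sup x : (0 <= w x)%R ->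
  dual w a x <= ereal_sup (range (fun k => (regularized_dual k x)%:E)).
Proof.
move=> wx; rewrite leNgt; apply/negP; set L := ereal_sup _ => Ldual.
have ub k : (regularized_dual k x)%:E <= L by apply: ereal_sup_ubound; exists k.
case: L ub Ldual => [r| |] ub Ldual; last 2 first.
- by have := leey (dual w a x); rewrite leNgt Ldual.
- by have := ub 0%N.
have r0 : (0 < r)%R by exact: lt_le_trans (regularized_dual_gt0 0 x) (ub 0%N).
(* [z] is the weight value whose dual is [r]. Then w x < z, and a shift 1/(k+1) below z - w x makes
   the regularized dual exceed [r]; this also covers w x = 0. *)
pose z := (r `^ (- (p - 1)))%R.
have za : (z `^ a = r)%R.
  by rewrite /z -powRrM mulrNN mulfV ?gt_eqF// powRr1// ltW.
have z0 : (0 < z)%R by exact: powR_gt0.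
have wz : (w x < z)%R.
  move: Ldual; rewrite /dual; case: eqP => [->//|/eqP wx0]; rewrite lte_fin => rw.
  rewrite ltNge; apply/negP => zw.
  have := le_dual_exponent z0 zw; rewrite za leNgt rw//.
pose k := Num.bound (z - w x)^-1%R.
have zw0 : (0 < z - w x)%R by rewrite subr_gt0.
have kz : (k.+1%:R^-1 < z - w x)%R.
  rewrite -[ltRHS]invrK ltf_pV2 ?posrE ?invr_gt0//.
  apply: lt_trans (archi_boundP _) _; first by rewrite invr_ge0 ltW.
  by rewrite ltr_nat.
have shz : (shifted_weight k x < z)%R.
  by rewrite /shifted_weight (max_idPl wx) addrC -ltrBrDr.
have := ub k; rewrite lee_fin leNgt => /negP; apply.
rewrite -za /regularized_dual !powRN ltf_pV2 ?posrE ?powR_gt0 ?shifted_weight_gt0//.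
by rewrite gt0_ltr_powR ?nnegrE ?invr_gt0 ?(ltW (shifted_weight_gt0 _ _)) ?(ltW z0).
Qed.

Lemma integral_dual_le (D : set X) (M : \bar R) : measurable D ->
  (forall k, \int[mu]_(x in D) (regularized_dual k x)%:E <= M) ->
  \int[mu]_(x in D) dual w a x <= M.
Proof.
move=> mD DM; pose g k x := (regularized_dual k x)%:E.
have g_nd x : {homo g^~ x : k l / (k <= l)%N >-> k <= l}.
  by move=> k l kl; rewrite lee_fin; exact: regularized_dual_nondecreasing.
have mg k : measurable_fun D (g k).
  by apply/measurable_EFinP/measurable_funTS; exact: measurable_regularized_dual.
have g0 k x : D x -> 0 <= g k x by move=> _; rewrite lee_fin ltW// regularized_dual_gt0.
have glim x : limn (g^~ x) = ereal_sup (range (g^~ x)).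
  by apply/cvg_lim => //; exact: ereal_nondecreasing_cvgn.
have mneg := measurable_lt_set 0 mw.
apply: (@le_trans _ _ (\int[mu]_(x in D) limn (g^~ x))).
  apply: ae_ge0_le_integral => //.
  - by move=> x _; exact/ltW/dual_gt0.
  - by apply: measurable_funTS; exact: measurable_dual.
  - move=> x Dx; rewrite glim; apply: le_trans (ereal_sup_ubound _).
      exact: (g0 0%N x Dx).
    by exists 0%N.
  - apply: (emeasurable_fun_cvg g) => // x Dx; rewrite glim.
    exact: ereal_nondecreasing_cvgn.
  exists [set x | (w x < 0)%R]; split=> // x /= /not_implyP[Dx].
  by apply: contra_notT; rewrite -leNgt glim; exact: dual_le_sup.
rewrite monotone_convergence//.
apply: lime_le.
  apply: ereal_nondecreasing_is_cvgn => k l kl; apply: ge0_le_integral => //.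
  - by move=> x; exact: g0.
  - by move=> x _; exact: g_nd.
by apply: nearW => k; exact: DM.
Qed.

End RegularizedDualWeight.

(** * Testing the weak-type inequality *)

Section Necessity.
Context (R : realType) (n : nat) (hn : (0 < n)%N).
Local Notation Rn := (Rn R n).
Local Notation mu := (@lebesgue R n).
Local Notation I := (cube_index R n).
Local Notation v := (fun i : I => side i ^+ n)%R.
Context (p : R) (p_gt1 : (1 < p)%R) (w : Rn -> R) (ww : weight w).
Local Notation weakQ i := (weakLp_norm 1 (fun x => (w x * \1_(cube_of i) x)%:E)).

Let p1_gt0 : (0 < p - 1)%R. Proof. by rewrite subr_gt0. Qed.
Let p_gt0 : (0 < p)%R. Proof. exact: lt_trans p_gt1. Qed.
Let pV_neq0 : (p^-1 != 0)%R. Proof. by rewrite invr_neq0// gt_eqF. Qed.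
Let mw : measurable_fun setT w. Proof. by case: ww. Qed.
Let w_lt0_null : mu [set x | (w x < 0)%R] = 0.
Proof. exact: weight_lt0_null. Qed.

Local Notation reg := (regularized_dual w p).

Lemma regularized_mass_fin k (i : I) : exists2 s : R, (0 < s)%R &
  \int[mu]_(x in cube_of i) (reg k x)%:E = s%:E.
Proof.
have mQ : measurable (cube_of i) by exact: measurable_cube.
have mreg : measurable_fun (cube_of i) (fun x => (reg k x)%:E).
  by apply/measurable_EFinP/measurable_funTS; exact: measurable_regularized_dual.
have pos : 0 < \int[mu]_(x in cube_of i) (reg k x)%:E.
  apply: integral_gt0 => //.
    exact: lebesgue_cube_gt0.
  by move=> x _; rewrite lte_fin; exact: regularized_dual_gt0.
have fin : \int[mu]_(x in cube_of i) (reg k x)%:E < +oo.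
  pose b := (k.+1%:R^-1 `^ (- (p - 1)^-1) : R)%R.
  apply: (@le_lt_trans _ _ (\int[mu]_(x in cube_of i) (cst b%:E x))).
    apply: ge0_le_integral => //.
    - by move=> x _; rewrite lee_fin; exact/ltW/regularized_dual_gt0.
    - by move=> x _; rewrite lee_fin; exact: regularized_dual_le.
  by rewrite integral_cst// [X in _ * X]lebesgue_cube -EFinM ltry.
exists (fine (\int[mu]_(x in cube_of i) (reg k x)%:E)).
  by rewrite fine_gt0// pos fin.
by rewrite fineK// ge0_fin_numE// ltW.
Qed.

Context (C : R).
Hypothesis weak_type : forall f : Rn -> R, Lp_weight p w f ->
  weakLp_norm p (fun x => (w x `^ p^-1)%:E * cube_maximal f x)
    <= C%:E * Lp_weight_norm p w f.

(** For the regularized sigma cut off to a cube, the maximal function is at least s / v on that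
    cube. The weak-type inequality at the level [lam] then reads lam |Y|^(1/p) <= |C| s^(1/p), and
    its p-th power is the claim. *)
Lemma distribution_test_function k (i : I) (s l : R) :
  \int[mu]_(x in cube_of i) (reg k x)%:E = s%:E -> (0 < s)%R -> (0 < l)%R ->
  l%:E * mu [set x | (l < `|w x * \1_(cube_of i) x|)%R] <=
  (`|C| `^ p * v i * (s / v i) `^ (1 - p))%:E.
Proof.
move=> hs s0 l0; pose f x := (reg k x * \1_(cube_of i) x)%R.
have mQ : measurable (cube_of i) by exact: measurable_cube.
have v0 : (0 < v i)%R by exact: volume_gt0.
have sv0 : (0 < s / v i)%R by rewrite divr_gt0.
have mf : measurable_fun setT f.
  apply: measurable_funM; first exact: measurable_regularized_dual.
  exact: measurable_indic.
have := integral_test_function p_gt1 mw w_lt0_null k mQ; rewrite hs => /andP[f0 fs].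
have norm_le : Lp_weight_norm p w f <= (s `^ p^-1)%:E.
  rewrite -poweR_EFin; apply: gt0_ler_poweR => //.
  - by rewrite invr_ge0 ltW.
  - by rewrite in_itv/= f0 leey.
  - by rewrite in_itv/= lee_fin leey ltW.
have fLp : Lp_weight p w f by split=> //; exact: le_lt_trans norm_le (ltry _).
pose lam := (l `^ p^-1 * (s / v i))%R.
have lp0 : (0 < l `^ p^-1)%R by exact: powR_gt0.
have lam0 : (0 < lam)%R by rewrite mulr_gt0.
pose Y := [set x | lam%:E < `|(w x `^ p^-1)%:E * cube_maximal f x|].
have mY : lam%:E * mu Y `^ p^-1 <= (`|C| * s `^ p^-1)%:E.
  apply: (@le_trans _ _ (C%:E * Lp_weight_norm p w f)).
    apply: le_trans (weak_type fLp).
    by apply: ereal_sup_ubound; exists lam.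
  (* The given constant has no prescribed sign; its absolute value can be raised to the power p. *)
  apply: (@le_trans _ _ (`|C|%:E * Lp_weight_norm p w f)).
    by apply: lee_wpmul2r; rewrite ?poweR_ge0// lee_fin ler_norm.
  by rewrite EFinM; apply: lee_wpmul2l.
have Ysub : [set x | (l < `|w x * \1_(cube_of i) x|)%R] `<=`
    [set x | (w x < 0)%R] `|` Y.
  move=> x /= lx; have [wx|wx] := ltP (w x) 0%R; [by left|right].
  move: lx; rewrite indicE; have [xi|] := boolP (x \in cube_of i); last first.
    by rewrite mulr0 normr0 ltNge (ltW l0).
  rewrite mulr1 ger0_norm// => lw.
  rewrite /Y/= gee0_abs; last by rewrite mule_ge0 ?lee_fin ?powR_ge0 ?cube_maximal_ge0.
  have wl : (l `^ p^-1 < w x `^ p^-1)%R.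
    by rewrite gt0_ltr_powR ?invr_gt0 ?nnegrE ?(ltW l0).
  apply: (@lt_le_trans _ _ ((w x `^ p^-1)%:E * (s / v i)%:E)).
    by rewrite -EFinM lte_fin /lam ltr_pM2r.
  apply: lee_wpmul2l; first by rewrite lee_fin powR_ge0.
  apply: le_trans (ereal_sup_ubound _); last first.
    by exists (cube_of i) => //; apply/cubeP; exists i.
  rewrite indicE xi mule1 cube_averageE.
  have -> : \int[mu]_(y in cube_of i) `|f y|%:E = s%:E.
    rewrite -hs; apply: eq_integral => y yi.
    by rewrite /f indicE yi mulr1 gtr0_norm//; exact: regularized_dual_gt0.
  by rewrite -EFinM lee_fin mulrC.
have mle : mu [set x | (l < `|w x * \1_(cube_of i) x|)%R] <= mu Y.
  have -> : mu Y = mu [set x | (w x < 0)%R] + mu Y by rewrite w_lt0_null add0e.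
  exact: le_trans (le_lebesgue Ysub) (outer_measureU2 _ _ _).
apply: (@le_trans _ _ (l%:E * mu Y)).
  by apply: lee_wpmul2l mle; rewrite lee_fin ltW.
have Y0 : 0 <= mu Y by exact: measure_ge0.
have Yfin : mu Y < +oo.
  apply: (lty_poweRy pV_neq0); rewrite ltey; apply: contraTneq mY => ->.
  by rewrite gt0_muley ?lte_fin// leye_eq.
have := @fineK _ (mu Y); rewrite ge0_fin_numE// => /(_ Yfin) Ym.
move: mY Y0; rewrite -Ym; set m := fine _.
rewrite poweR_EFin -!EFinM !lee_fin => mY m0.
have mp0 : (0 <= m `^ p^-1)%R by exact: powR_ge0.
have : ((lam * m `^ p^-1) `^ p <= (`|C| * s `^ p^-1) `^ p)%R.
  rewrite ge0_ler_powR ?nnegrE ?(ltW p_gt0)//.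
  - by rewrite mulr_ge0// ltW.
  - by rewrite mulr_ge0// powR_ge0.
rewrite (powRM _ (ltW lam0) mp0) (powRM _ (normr_ge0 _) (powR_ge0 _ _)).
rewrite /lam (powRM _ (ltW lp0) (ltW sv0)) -!powRrM !mulVf ?gt_eqF//.
rewrite !powRr1 ?(ltW s0) ?(ltW l0)//.
have svp0 : (0 < (s / v i) `^ p)%R by exact: powR_gt0.
have -> : ((s / v i) `^ (1 - p) = (s / v i) / (s / v i) `^ p)%R.
  by rewrite powRB ?powRr1 ?(ltW sv0)// (gt_eqF sv0) implybT.
move=> h; rewrite -(ler_pM2r svp0).
have -> : (`|C| `^ p * v i * (s / v i / (s / v i) `^ p) * (s / v i) `^ p = `|C| `^ p * s)%R.
  by field; rewrite !gt_eqF.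
by apply: le_trans h; rewrite mulrAC.
Qed.

Lemma Apstar_necessary : Apstar p w.
Proof.
pose B := (`|C| `^ p)%R; have B0 : (0 <= B)%R by exact: powR_ge0.
apply: (@le_lt_trans _ _ B%:E); last exact: ltry.
apply: ge_ereal_sup => _ [_ /cubeP[i ->] <-].
have v0 : (0 < v i)%R by exact: volume_gt0.
rewrite cube_averageE dual_weightE// lebesgue_cube inver gt_eqF//.
have Wle k s : \int[mu]_(x in cube_of i) (reg k x)%:E = s%:E -> (0 < s)%R ->
    weakQ i <= (B * v i * (s / v i) `^ (1 - p))%:E.
  move=> hs s0; apply: ge_ereal_sup => _ [l /= l0 <-].
  by rewrite invr1 poweRe1//; exact: distribution_test_function hs s0 l0.
have W0 : 0 <= weakQ i by exact: weakLp_norm_ge0.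
(* With zero weak norm the product is zero even if the sigma-mass is infinite; otherwise one may
   divide by the norm. *)
have [->|WN0] := eqVneq (weakQ i) 0; first by rewrite mule0 mul0e lee_fin.
have [s0 s00 hs0] := regularized_mass_fin 0 i.
have Wfin : weakQ i < +oo by exact: le_lt_trans (Wle 0%N _ hs0 s00) (ltry _).
have := @fineK _ (weakQ i); rewrite ge0_fin_numE// => /(_ Wfin) WE.
move: Wle WN0 W0; rewrite -WE; set om := fine _ => Wle WN0 W0.
have om0 : (0 < om)%R by rewrite -lte_fin lt0e WN0.
(* Solving the bound [Wle] for the average of the regularized sigma gives [M], which does not depend
   on [k], so it survives the limit. *)
pose M := ((B * v i / om) `^ (p - 1)^-1)%R.
have dualM : \int[mu]_(x in cube_of i) dual w (- (p - 1)^-1) x <= (v i * M)%:E.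
  apply: integral_dual_le => //; first exact: measurable_cube.
  move=> k; have [s sk hs] := regularized_mass_fin k i; rewrite hs lee_fin.
  have sv0 : (0 < s / v i)%R by rewrite divr_gt0.
  rewrite mulrC -ler_pdivrMr//.
  have X0 : (0 < (s / v i) `^ (p - 1))%R by exact: powR_gt0.
  have h : ((s / v i) `^ (p - 1) <= B * v i / om)%R.
    have := Wle k s hs sk; rewrite lee_fin -opprB powRN => omX.
    by rewrite ler_pdivlMr// mulrC -ler_pdivlMr.
  have -> : (s / v i = ((s / v i) `^ (p - 1)) `^ (p - 1)^-1)%R.
    by rewrite -powRrM mulfV ?gt_eqF// powRr1// ltW.
  rewrite ge0_ler_powR ?nnegrE ?invr_ge0 ?(ltW p1_gt0) ?powR_ge0//.
  by rewrite divr_ge0 ?mulr_ge0 ?(ltW om0) ?(ltW v0).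
have dual0 : 0 <= \int[mu]_(x in cube_of i) dual w (- (p - 1)^-1) x.
  by apply: integral_ge0 => x _; exact/ltW/dual_gt0.
have vV0 : (0 <= (v i)^-1)%R by rewrite invr_ge0; exact: ltW.
apply: (@le_trans _ _ ((v i)^-1%:E * om%:E * (M%:E `^ (p - 1)))).
  apply: lee_wpmul2l; first by rewrite -EFinM lee_fin mulr_ge0 ?(ltW om0).
  apply: gt0_ler_poweR; first exact: ltW.
  - by rewrite in_itv/= leey andbT mule_ge0.
  - by rewrite in_itv/= leey andbT lee_fin powR_ge0.
  apply: le_trans (lee_wpmul2l _ dualM) _; first by rewrite lee_fin.
  by rewrite -EFinM lee_fin mulrA mulVf ?mul1r// gt_eqF.
rewrite poweR_EFin -!EFinM lee_fin /M -powRrM mulVf ?gt_eqF// powRr1; last first.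
  by rewrite divr_ge0 ?mulr_ge0 ?(ltW om0) ?(ltW v0).
by rewrite le_eqVlt; apply/orP; left; apply/eqP; field; rewrite !gt_eqF.
Qed.

End Necessity.

Theorem theorem1p2 (R : realType) (n : nat) (hn : (0 < n)%N) (p : R)
    (hp : (1 < p)%R) (w : Rn R n -> R) (hw : weight w) :
  (exists C : R, forall f : Rn R n -> R, Lp_weight p w f ->
     weakLp_norm p (fun x => (w x `^ p^-1)%:E * cube_maximal f x)
       <= C%:E * Lp_weight_norm p w f)
  <-> Apstar p w.
Proof.
split=> [[C weak_type]|]; first exact: Apstar_necessary weak_type.
exact: Apstar_sufficient.
Qed.
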